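(* Let $H$, $A$, $V=D(A^{1/2})$, $\mathcal{H}=V\times H\times V\times H$ and the constants $a,b,\gamma>0$ be as in the context, and for $\theta\in[-1,1]$ let $\mathcal{A}_\theta$ be the operator on $\mathcal{H}$ defined in the context by $$\mathcal{A}_\theta(u,v,w,z)=\big(v,\,-aAu-\gamma A^\theta(v+z),\,z,\,-bAw-\gamma A^\theta(v+z)\big),$$ with $(S_\theta(t))_{t\ge0}$ the $C_0$-semigroup of contractions it generates on $\mathcal{H}$. Assume $a\neq b$. (1) For every $\theta\in[0,1]$, the semigroup $(S_\theta(t))_{t\ge0}$ is exponentially stable. More precisely, there exist positive constants $K$ and $\xi$ such that $$\|S_\theta(t)\|_{\mathcal{L}(\mathcal{H})}\le K\exp(-\xi t)\qquad\text{for all }t\ge0 .$$ (2) For every $\theta\in[-1,0)$, the semigroup $(S_\theta(t))_{t\ge0}$ is not exponentially stable. However, it is polynomially stable: there exists a positive constant $K_0$ such that $$\|S_\theta(t)Z^0\|_{\mathcal{H}}\le\frac{K_0\,\|Z^0\|_{D(\mathcal{A}_\theta)}}{(1+t)^{-\frac{1}{2\theta}}}\qquad\text{for all }Z^0\in D(\mathcal{A}_\theta)\text{ and all }t\ge0 .$$ Furthermore, the polynomial decay rate is optimal; more precisely, for every $\theta\in[-1,0)$ and every $r\in[0,-2\theta)$, $$\limsup_{|\lambda|\to\infty,\ \lambda\in\mathbb{R}}|\lambda|^{-r}\,\big\|(i\lambda I-\mathcal{A}_\theta)^{-1}\big\|_{\mathcal{L}(\mathcal{H})}=\infty .$$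
   Context: $H$ is a complex Hilbert space with inner product $(\cdot,\cdot)$ and norm $|\cdot|$. $A$ is a positive unbounded self-adjoint operator on $H$ with domain $D(A)$ dense in $H$, and $V=D(A^{1/2})$. It is assumed that $V\hookrightarrow H\hookrightarrow V'$, each injection being dense and compact, where $V'$ is the topological dual of $V$, and that there exists $a_0>0$ such that $|u|\le a_0|A^{1/2}u|$ for all $u\in V$. The numbers $a,b,\gamma$ are positive constants, and $\theta\in[-1,1]$. The space $\mathcal{H}=V\times H\times V\times H$, over $\mathbb{C}$, is a Hilbert space with the norm $$\|Z\|^2=a|A^{1/2}u|^2+|v|^2+b|A^{1/2}w|^2+|z|^2,\qquad Z=(u,v,w,z)\in\mathcal{H}.$$ The operator $\mathcal{A}_\theta$ is defined by $\mathcal{A}_\theta(u,v,w,z)=(v,\,-(aAu+\gamma A^\theta(v+z)),\,z,\,-(bAw+\gamma A^\theta(v+z)))$ on the domain $$D(\mathcal{A}_\theta)=\{(u,v,w,z)\in V^4:\ aAu+\gamma A^\theta(v+z)\in H\ \text{and}\ bAw+\gamma A^\theta(v+z)\in H\},$$ where the sums are understood in $V'$ (with $A$ extended to a bounded operator $V\to V'$). It is the generator associated with the system $y_{tt}+aAy+\gamma A^\theta(y_t+z_t)=0$, $z_{tt}+bAz+\gamma A^\theta(y_t+z_t)=0$. It generates a $C_0$-semigroup of contractions $(S_\theta(t))_{t\ge0}$ on $\mathcal{H}$, and, when $a\ne b$, $i\mathbb{R}\subset\rho(\mathcal{A}_\theta)$, the resolvent set of $\mathcal{A}_\theta$. $D(\mathcal{A}_\theta)$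 is equipped with the graph norm $\|\cdot\|_{D(\mathcal{A}_\theta)}$. A semigroup is exponentially stable if its operator norm is bounded by $K e^{-\xi t}$ for some constants $K,\xi>0$ and all $t\ge0$. *)

(* Defs.v *)
From HB Require Import structures.
From mathcomp Require Import all_boot all_order all_algebra sesquilinear.
From mathcomp Require Import all_classical all_reals all_analysis.
From mathcomp Require Import complex.

Set Implicit Arguments.
Unset Strict Implicit.
Unset Printing Implicit Defensive.

Import Order.TTheory GRing.Theory Num.Theory.
Import numFieldNormedType.Exports.

Local Open Scope classical_set_scope.
Local Open Scope ring_scope.
Local Open Scope complex_scope.

(* Norms of normed R[i]-modules take values in R[i]; cnorm is the same norm
   read in R. *)
Definition cnorm (R : realType) (H : normedModType R[i]) (x : H) : R :=
  complex.Re `|x|.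

(* The inner product is linear in its first argument and conjugate-linear in
   the second; [hilbert_norm] makes the given complete norm the one it
   induces. *)
Definition hilbert_norm (R : realType) (H : completeNormedModType R[i])
    (ip : {dot H for (@Num.conj R[i])}) : Prop :=
  forall x : H, `|x| ^+ 2 = ip x x.

(* Values of [op_fun] outside [dom] are irrelevant. *)
Record operator (H : Type) := Operator { dom : set H; op_fun :> H -> H }.

Section HilbertOperators.
Variables (R : realType) (H : completeNormedModType R[i]).
Variable ip : {dot H for (@Num.conj R[i])}.
Implicit Types A B : operator H.

Definition linear_operator A : Prop :=
  dom A 0 /\
  forall (c : R[i]) (x y : H), dom A x -> dom A y ->
    dom A (c *: x + y) /\ A (c *: x + y) = c *: A x + A y.

(* A = A^*, as an equality of graphs: the right-hand side of the equivalence
   says that u is in D(A^* ) with A^* u = w. *)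
Definition selfadjoint A : Prop :=
  [/\ linear_operator A, dense (dom A) &
      forall u w : H, (dom A u /\ A u = w) <->
                      (forall x, dom A x -> ip (A x) u = ip x w)].

Definition positive_operator A : Prop :=
  forall x, dom A x -> 0 <= ip (A x) x.

Definition unbounded_operator A : Prop :=
  ~ exists M : R, forall x, dom A x -> cnorm (A x) <= M * cnorm x.

(* B is the positive self-adjoint square root A^{1/2} (which is unique), the
   composition B o B being taken with its natural domain. *)
Definition is_sqrt_of A B : Prop :=
  [/\ selfadjoint B, positive_operator B &
      forall x y : H, (dom A x /\ A x = y) <->
                      [/\ dom B x, dom B (B x) & B (B x) = y]].

Definition is_eigenbasis A (p : (nat -> R) * (nat -> H)) : Prop :=
  [/\ forall n, dom A (p.2 n) /\ A (p.2 n) = (p.1 n)%:C *: p.2 n,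
      forall m n, ip (p.2 m) (p.2 n) = (m == n)%:R &
      forall x, (forall n, ip x (p.2 n) = 0) -> x = 0].

Definition eigenbasis A : (nat -> R) * (nat -> H) :=
  get [set p | is_eigenbasis A p].

(* Partial sums of  sum_n mu_n^s (x, e_n) e_n. *)
Definition fpow_series A (s : R) (x : H) : nat -> H :=
  let: (mu, e) := eigenbasis A in
  series (fun n => ((mu n `^ s)%:C * ip x (e n)) *: e n).

(* A^s for a positive self-adjoint operator with compact resolvent, through its
   spectral expansion; neither the domain nor the value depends on the
   orthonormal basis of eigenvectors picked by [eigenbasis]. *)
Definition fpow A (s : R) : operator H :=
  Operator [set x | cvgn (fpow_series A s x)]
           (fun x => limn (fpow_series A s x)).

(* Below, A12 stands for A^{1/2} and V = dom A12 carries the norm |A12 u|. *)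

(* V' is made of the bounded conjugate-linear functionals on V, so that
   h |-> (h, .) is a linear embedding of H into V'.  Such a functional is
   given by a function on H of which only the values on V matter. *)
Definition in_dual A12 (f : H -> R[i]) : Prop :=
  (forall (c : R[i]) (p q : H), dom A12 p -> dom A12 q ->
     f (c *: p + q) = Num.conj c * f p + f q) /\
  exists M : R, forall p, dom A12 p -> complex.Re `|f p| <= M * cnorm (A12 p).

Definition dual_norm A12 (f : H -> R[i]) : R :=
  sup [set complex.Re `|f p| | p in [set p | dom A12 p /\ cnorm (A12 p) <= 1]].

Definition to_dual (h : H) : H -> R[i] := fun p => ip h p.

(* The extension of A to a bounded operator V -> V'. *)
Definition A_dual A12 (u : H) : H -> R[i] := fun p => ip (A12 u) (A12 p).

(* A^theta v as an element of V', for v in V and theta <= 1: since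
   V is contained in D(A^{theta/2}), the functional p |-> (A^theta v, p) extends
   from v in D(A^theta) to v in V as follows. *)
Definition fpow_dual A (theta : R) (v : H) : H -> R[i] :=
  fun p => ip (fpow A (theta / 2) v) (fpow A (theta / 2) p).

End HilbertOperators.

(* Embeddings of a normed space (X, NX) into a normed space (Y, NY), the spaces
   being given as subsets of ambient additive groups. *)
Definition dense_embedding (R : realType) (E F : zmodType)
    (X : set E) (Y : set F) (NY : F -> R) (j : E -> F) : Prop :=
  forall y, Y y -> forall eps : R, 0 < eps ->
    exists2 x, X x & NY (j x - y) < eps.

Definition compact_embedding (R : realType) (E F : zmodType)
    (X : set E) (NX : E -> R) (Y : set F) (NY : F -> R) (j : E -> F) : Prop :=
  forall x : nat -> E, (forall n, X (x n)) ->
    (exists M : R, forall n, NX (x n) <= M) ->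
    exists (k : nat -> nat) (y : F),
      [/\ forall n, (k n < k n.+1)%N, Y y &
          NY (j (x (k n)) - y) @[n --> \oo] --> (0 : R)].

(* V -> H -> V', each embedding dense and compact. *)
Definition compact_triple (R : realType) (H : completeNormedModType R[i])
    (ip : {dot H for (@Num.conj R[i])}) (A12 : operator H) : Prop :=
  [/\ dense_embedding (dom A12) setT (@cnorm R H) id,
      compact_embedding (dom A12) (fun u => cnorm (A12 u))
                        setT (@cnorm R H) id,
      dense_embedding setT (in_dual A12) (dual_norm A12) (to_dual ip) &
      compact_embedding setT (@cnorm R H)
                        (in_dual A12) (dual_norm A12) (to_dual ip)].

(* X is a subspace of E with norm N (not the ambient norm of E, if any).
   Operators on X are given by their graphs. *)
Section Semigroups.
Variables (R : realType) (E : lmodType R[i]) (X : set E) (N : E -> R).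

Definition opnorm (G : E -> E -> Prop) : \bar R :=
  ereal_sup [set (N W)%:E | W in [set W |
    exists Z, [/\ X Z, N Z <= 1 & G Z W]]].

Definition graph_on (T : E -> E) : E -> E -> Prop :=
  fun Z W => X Z /\ W = T Z.

(* The graph of (z I - G)^{-1}. *)
Definition resolvent (G : E -> E -> Prop) (z : R[i]) : E -> E -> Prop :=
  fun F U => exists2 W, G U W & F = z *: U - W.

Definition contraction_semigroup (S : R -> E -> E) : Prop :=
  [/\ forall t Z, 0 <= t -> X Z -> X (S t Z) /\ N (S t Z) <= N Z,
      forall t (c : R[i]) Z W, 0 <= t -> X Z -> X W ->
        S t (c *: Z + W) = c *: S t Z + S t W,
      forall Z, X Z -> S 0 Z = Z,
      forall s t Z, 0 <= s -> 0 <= t -> X Z -> S (s + t) Z = S s (S t Z) &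
      forall Z, X Z -> N (S t Z - Z) @[t --> 0^'+] --> (0 : R)].

Definition generator (S : R -> E -> E) (Z W : E) : Prop :=
  [/\ X Z, X W &
      N ((t^-1)%:C *: (S t Z - Z) - W) @[t --> 0^'+] --> (0 : R)].

Definition generates (G : E -> E -> Prop) (S : R -> E -> E) : Prop :=
  contraction_semigroup S /\ forall Z W, G Z W <-> generator S Z W.

Definition exponentially_stable (S : R -> E -> E) : Prop :=
  exists K xi : R, [/\ 0 < K, 0 < xi &
    forall t, 0 <= t ->
      (opnorm (graph_on (S t)) <= (K * expR (- (xi * t)))%:E)%E].

(* For W the image of Z under the operator. *)
Definition graph_norm (Z W : E) : R := N Z + N W.

End Semigroups.

(* The filter of the neighbourhoods of |lambda| = oo on the real line. *)
Definition abs_infty (R : realType) : set_system R :=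
  [set P | exists M : R, forall lambda : R, M < `|lambda| -> P lambda].

Section CoupledSystem.
Variables (R : realType) (H : completeNormedModType R[i]).
Variable ip : {dot H for (@Num.conj R[i])}.
Variables (A A12 : operator H) (a b gamma : R).

Definition energy_space : set (H * H * H * H)%type :=
  [set Z | let: (u, v, w, z) := Z in dom A12 u /\ dom A12 w].

Definition energy_norm (Z : (H * H * H * H)%type) : R :=
  let: (u, v, w, z) := Z in
  Num.sqrt (a * cnorm (A12 u) ^+ 2 + cnorm v ^+ 2 +
            b * cnorm (A12 w) ^+ 2 + cnorm z ^+ 2).

(* The graph of A_theta: f and g are the elements of H that
   a A u + gamma A^theta (v + z) and b A w + gamma A^theta (v + z), computed in
   V', are required to be. *)
Definition A_theta (theta : R) (Z W : (H * H * H * H)%type) : Prop :=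
  let: (u, v, w, z) := Z in
  [/\ dom A12 u, dom A12 v, dom A12 w & dom A12 z] /\
  exists f g : H,
    [/\ forall p, dom A12 p ->
          a%:C * A_dual ip A12 u p + gamma%:C * fpow_dual ip A theta (v + z) p
          = to_dual ip f p,
        forall p, dom A12 p ->
          b%:C * A_dual ip A12 w p + gamma%:C * fpow_dual ip A theta (v + z) p
          = to_dual ip g p &
        W = (v, - f, z, - g)].

End CoupledSystem.

(* Main.v *)
(* Idea. A has compact resolvent, so it is diagonal in an orthonormal basis of
   eigenvectors e_n, A e_n = mu_n e_n, and the system splits into independent
   oscillator pairs: with U = sqrt(mu_n) u, W = sqrt(mu_n) w, om = sqrt(mu_n) and
   d = gamma mu_n^theta,
     U' = om v,  v' = - a om U - d (v + z),
     W' = om z,  z' = - b om W - d (v + z).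
   The energy E only dissipates s = v + z, but since a <> b the chain
   s -> P = a U + b W -> q = a v + b z -> Q = a^2 U + b^2 W of successive
   derivatives determines the whole state.  Adding a small multiple of
   s P - k1 P q + k2 q Q to E gives a Lyapunov function which decays at rate
   c min(d, om^2 / d), with c depending only on a and b.  This rate is bounded
   below in n when theta is in [0, 1] and is of order mu_n^theta when theta < 0;
   summing over n (Parseval) gives the two decay estimates, the weight mu_n lost
   in the second one being paid for by the graph norm.  Conversely
   E' >= - 4 d E with d -> 0 excludes exponential decay for theta < 0, and the
   vectors (e_n, i lam e_n, 0, 0) with lam^2 = a mu_n make the resolvent at i lam
   at least 1 / d. *)

(* [fpow], and hence [A_theta], refers to a basis picked by [get], so the existence of an eigenbasis
   has to be proved before anything can be said about the system. Eigenvectors are produced one at a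
   time by minimising |A^{1/2} y|^2 on the unit sphere of the complement of the earlier ones; the
   compact embedding of V in H supplies the minimiser. The semigroup is given only through its
   generator, and orbits are differentiable only from data in the domain. Each complex mode is
   therefore read through bounded real functionals, the real inner products with e_n and i e_n,
   which turn such orbits into real oscillator flows. Truncations to finitely many modes lie in the
   domain and are dense, which carries the upper bounds to all data. The small factor in the
   Lyapunov function is a constant times min(d / om, om / d). It keeps the correction below half the
   energy and lets the dissipation 2 d s^2 absorb every cross term, for weak and strong damping
   alike; multiplied by om it gives the rate min(d, om^2 / d). For theta < 0, trading exp(-c
   mu^theta t) for (1 + t)^(1/theta) costs one factor mu in the squared norm, hence the exponent
   1/(2 theta) for the norm. *)
Require Import Defs.
From HB Require Import structures.
From mathcomp Require Import all_boot all_order all_algebra sesquilinear.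
From mathcomp Require Import all_classical all_reals all_analysis.
From mathcomp Require Import complex ring lra.

Set Implicit Arguments.
Unset Strict Implicit.
Unset Printing Implicit Defensive.

Import Order.TTheory GRing.Theory Num.Theory.
Import numFieldNormedType.Exports.

Local Open Scope classical_set_scope.
Local Open Scope ring_scope.
Local Open Scope complex_scope.

(** * Norm and inner product *)

Section HilbertSpace.
Context {R : realType} {H : completeNormedModType R[i]}.
Variable ip : {dot H for (@Num.conj R[i])}.
Hypothesis norm_ip : hilbert_norm ip.
Implicit Types x y z : H.

Lemma normC_Re (c : R[i]) : `|c| = (complex.Re `|c|)%:C.
Proof. by rewrite RRe_real // ger0_real. Qed.

Lemma Re_normMr (r : R) (c : R[i]) : complex.Re `|r%:C * c| = `|r| * complex.Re `|c|.
Proof.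
rewrite normrM [`|r%:C|]normc_def [`|c|]normC_Re /= expr0n addr0 sqrtr_sqr.
by rewrite mul0r subr0.
Qed.

Lemma normC_sqr (c : R[i]) : `|c| ^+ 2 = (complex.Re `|c| ^+ 2)%:C.
Proof. by rewrite [in LHS]normC_Re -rmorphXn. Qed.

Lemma normr_cnorm x : `|x| = (cnorm x)%:C.
Proof. by rewrite /cnorm RRe_real // ger0_real. Qed.

Lemma cnorm_ge0 x : 0 <= cnorm x.
Proof. by rewrite -ler0c -normr_cnorm. Qed.

Lemma cnormD x y : cnorm (x + y) <= cnorm x + cnorm y.
Proof. by rewrite -lecR raddfD /= -!normr_cnorm ler_normD. Qed.

Lemma cnormN x : cnorm (- x) = cnorm x.
Proof. by rewrite /cnorm normrN. Qed.

Lemma cnormBC x y : cnorm (x - y) = cnorm (y - x).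
Proof. by rewrite -cnormN opprB. Qed.

Lemma cnorm0 : cnorm (0 : H) = 0.
Proof. by rewrite /cnorm normr0. Qed.

Lemma cnorm_eq0 x : (cnorm x == 0) = (x == 0).
Proof. by rewrite -[RHS]normr_eq0 normr_cnorm eq_complex /= eqxx andbT. Qed.

Lemma cnormZ (c : R[i]) x : cnorm (c *: x) = complex.Re `|c| * cnorm x.
Proof.
apply: complexI; rewrite rmorphM /= -!normr_cnorm normrZ.
by congr (_ * _); rewrite RRe_real // ger0_real.
Qed.

Lemma cnormZr (r : R) x : cnorm (r%:C *: x) = `|r| * cnorm x.
Proof. by rewrite cnormZ normc_def /= expr0n addr0 sqrtr_sqr. Qed.

(** Signs, limits and derivatives are handled in [R]. Nothing is lost, since pairing with
    ['i%C *: y] recovers the imaginary part. *)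
Definition rip x y : R := complex.Re (ip x y).

Lemma ipxx x : ip x x = (cnorm x ^+ 2)%:C.
Proof. by rewrite -norm_ip normr_cnorm rmorphXn. Qed.

Lemma cnorm_sqr x : cnorm x ^+ 2 = rip x x.
Proof. by rewrite /rip ipxx. Qed.

Lemma ipC x y : ip x y = (ip y x)^*%C.
Proof. by rewrite hermC expr0 mul1r. Qed.

Lemma ripC x y : rip x y = rip y x.
Proof. by rewrite /rip ipC; case: (ip y x). Qed.

Lemma ripDl x y z : rip (x + y) z = rip x z + rip y z.
Proof. by rewrite /rip linearDl raddfD. Qed.

Lemma ripNl x y : rip (- x) y = - rip x y.
Proof. by rewrite /rip linearNl raddfN. Qed.

Lemma ripDr x y z : rip z (x + y) = rip z x + rip z y.
Proof. by rewrite ![rip z _]ripC ripDl. Qed.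

Lemma ripNr x y : rip x (- y) = - rip x y.
Proof. by rewrite ripC ripNl ripC. Qed.

Lemma ripBl x y z : rip (x - y) z = rip x z - rip y z.
Proof. by rewrite ripDl ripNl. Qed.

Lemma ip0l y : ip 0 y = 0. Proof. by rewrite linear0l. Qed.
Lemma ip0r y : ip y 0 = 0. Proof. by rewrite linear0r. Qed.

Lemma ipDl x y z : ip (x + y) z = ip x z + ip y z.
Proof. by rewrite linearDl. Qed.

Lemma ipDr x y z : ip z (x + y) = ip z x + ip z y.
Proof. by rewrite linearDr. Qed.

Lemma ipNl x y : ip (- x) y = - ip x y.
Proof. by rewrite linearNl. Qed.

Lemma ipZl (c : R[i]) x y : ip (c *: x) y = c * ip x y.
Proof. by rewrite linearZl_LR. Qed.

Lemma ipZr (c : R[i]) x y : ip x (c *: y) = c^*%C * ip x y.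
Proof. by rewrite linearZr_LR. Qed.

Lemma ipZrr (r : R) x y : ip x (r%:C *: y) = r%:C * ip x y.
Proof. by rewrite ipZr conjc_real. Qed.

Lemma ip_suml (I : Type) (r : seq I) (P : pred I) (F : I -> H) y :
  ip (\sum_(i <- r | P i) F i) y = \sum_(i <- r | P i) ip (F i) y.
Proof. by apply: (big_morph (fun x => ip x y)) => [u v|]; rewrite ?ip0l ?ipDl. Qed.

Lemma ip_sumr (I : Type) (r : seq I) (P : pred I) (F : I -> H) y :
  ip y (\sum_(i <- r | P i) F i) = \sum_(i <- r | P i) ip y (F i).
Proof. by apply: (big_morph (ip y)) => [u v|]; rewrite ?ip0r ?ipDr. Qed.

Lemma ripZl (r : R) x y : rip (r%:C *: x) y = r * rip x y.
Proof. by rewrite /rip ipZl; case: (ip x y) => p q /=; rewrite mul0r subr0. Qed.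

Lemma ripZr (r : R) x y : rip x (r%:C *: y) = r * rip x y.
Proof. by rewrite ripC ripZl ripC. Qed.

Lemma rip_i x y : rip x ('i%C *: y) = complex.Im (ip x y).
Proof. by rewrite /rip ipZr; case: (ip x y) => p q /=; ring. Qed.

Lemma cauchy_schwarz x y : `|rip x y| <= cnorm x * cnorm y.
Proof.
have [y0|y0] := eqVneq y 0.
  by rewrite y0 /rip ip0r normr0 cnorm0 mulr0.
have ny : 0 < cnorm y ^+ 2 by rewrite exprn_gt0 // lt0r cnorm_eq0 y0 cnorm_ge0.
have : 0 <= cnorm y ^+ 2 * cnorm ((cnorm y ^+ 2)%:C *: x - (rip x y)%:C *: y) ^+ 2.
  by rewrite mulr_ge0 ?sqr_ge0.
rewrite (cnorm_sqr (_ - _)) ripBl !ripDr !ripNr !ripZl !ripZr.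
rewrite -!cnorm_sqr (ripC y x) => h.
rewrite -(@ler_pXn2r _ 2) ?nnegrE ?mulr_ge0 ?cnorm_ge0 // real_normK ?num_real // exprMn.
rewrite -subr_ge0.
have n2: 0 < cnorm y ^+ 2 * cnorm y ^+ 2 by rewrite mulr_gt0.
by rewrite -(pmulr_rge0 _ n2); move: h; congr (_ <= _); ring.
Qed.

(** Multiplying [x] by the conjugate of [ip x y] makes the inner product real and nonnegative, which
    reduces the claim to the real inequality. *)
Lemma ip_norm_le x y : complex.Re `|ip x y| <= cnorm x * cnorm y.
Proof.
set c := ip x y; have [->|c0] := eqVneq c 0; first by rewrite normr0 mulr_ge0 ?cnorm_ge0.
have nc : 0 < complex.Re `|c| by rewrite -ltcR RRe_real ?normr_gt0 // ger0_real.
have := le_trans (ler_norm _) (cauchy_schwarz (c^*%C *: x) y).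
rewrite cnormZ normcJ -mulrA => h; rewrite -(ler_pM2l nc); move: h; congr (_ <= _).
rewrite /rip ipZl -/c [_ * c]mulrC -sqr_normc.
by rewrite normC_sqr expr2.
Qed.

Lemma cnormD_sqr x y :
  cnorm (x + y) ^+ 2 = cnorm x ^+ 2 + 2 * rip x y + cnorm y ^+ 2.
Proof. by rewrite !cnorm_sqr ripDl !ripDr (ripC y x); ring. Qed.

Lemma cnormB_sqr x y :
  cnorm (x - y) ^+ 2 = cnorm x ^+ 2 - 2 * rip x y + cnorm y ^+ 2.
Proof. by rewrite cnormD_sqr cnormN ripNr; ring. Qed.

Lemma hilbert_cvgP (u : nat -> H) (l : H) :
  u @ \oo --> l <->
  forall eps : R, 0 < eps -> exists N, forall n, (N <= n)%N -> cnorm (u n - l) < eps.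
Proof.
split=> [/cvgrPdist_lt ul eps e0|ul].
  have /ul [N _ hN] : 0 < eps%:C by rewrite ltcR.
  exists N => n /hN /=.
  by rewrite normr_cnorm ltcR cnormBC.
apply/cvgrPdist_lt => e e0.
have eE : e = (complex.Re e)%:C by rewrite RRe_real // gtr0_real.
have /ul[N hN] : 0 < complex.Re e by rewrite -ltcR -eE.
exists N => // n /= /hN.
by rewrite normr_cnorm eE ltcR cnormBC.
Qed.

Lemma hilbert_cauchy_cvg (u : nat -> H) :
  (forall eps : R, 0 < eps -> exists N, forall m n, (N <= m)%N -> (m <= n)%N ->
    cnorm (u n - u m) < eps) -> cvgn u.
Proof.
move=> cu; apply/cauchy_cvgP/cauchy_exP => e e0.
have eE : e = (complex.Re e)%:C by rewrite RRe_real // gtr0_real.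
have /cu[N hN] : 0 < complex.Re e by rewrite -ltcR -eE.
exists (u N); exists N => // n /= Nn; rewrite -ball_normE /= normr_cnorm eE ltcR.
by rewrite cnormBC hN.
Qed.

Lemma cvg_cnormP (u : nat -> H) (l : H) :
  u @ \oo --> l <-> cnorm (u n - l) @[n --> \oo] --> (0 : R).
Proof.
split=> [/hilbert_cvgP h|/cvgrPdist_lt h].
  apply/cvgrPdist_lt => e /h [N hN]; exists N => // n /= /hN.
  by rewrite sub0r normrN ger0_norm ?cnorm_ge0.
apply/hilbert_cvgP => e /h [N _ hN]; exists N => n /hN /=.
by rewrite sub0r normrN ger0_norm ?cnorm_ge0.
Qed.

Lemma cvg_rip (u : nat -> H) (l y : H) :
  u @ \oo --> l -> rip (u n) y @[n --> \oo] --> rip l y.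
Proof.
move=> /hilbert_cvgP ul; apply/cvgrPdist_lt => e e0.
have p0 : 0 < 1 + cnorm y by rewrite ltr_pwDl // cnorm_ge0.
have [] := ul (e / (1 + cnorm y)); first by rewrite divr_gt0.
move=> N hN; exists N => // n /= /hN h.
rewrite distrC -ripBl (le_lt_trans (cauchy_schwarz _ _)) //.
rewrite (@le_lt_trans _ _ (cnorm (u n - l) * (1 + cnorm y))) //.
  by rewrite ler_wpM2l ?cnorm_ge0 // lerDr.
by rewrite -ltr_pdivlMr.
Qed.

Lemma cvg_cnorm (u : nat -> H) (l : H) :
  u @ \oo --> l -> cnorm (u n) @[n --> \oo] --> cnorm l.
Proof.
move=> /hilbert_cvgP ul; apply/cvgrPdist_lt => e /ul [N hN].
exists N => // n /= /hN; apply: le_lt_trans; rewrite ler_norml; apply/andP; split.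
  by rewrite lerNl opprB lerBlDr (le_trans _ (cnormD _ _)) // subrK.
by rewrite lerBlDr cnormBC (le_trans _ (cnormD _ _)) // subrK.
Qed.

Lemma ip_eq_rip x y z w :
  rip x y = rip z w -> rip x ('i%C *: y) = rip z ('i%C *: w) -> ip x y = ip z w.
Proof.
rewrite !rip_i /rip; case: (ip x y) => p q; case: (ip z w) => p' q' /= -> ->.
by [].
Qed.

Lemma cvg_ip_eq (u : nat -> H) (l y : H) (d : R[i]) N :
  u @ \oo --> l -> (forall n, (N <= n)%N -> ip (u n) y = d) -> ip l y = d.
Proof.
move=> ul ud.
have key z r : (forall n, (N <= n)%N -> rip (u n) z = r) -> rip l z = r.
  move=> h; rewrite -(cvg_lim (@norm_hausdorff _ _) (cvg_rip (y := z) ul)).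
  apply: cvg_lim; first exact: norm_hausdorff.
  by apply: cvg_near_cst; exists N => // n /= /h.
rewrite -(ud N (leqnn N)); apply: ip_eq_rip; apply: key => n hn.
  by rewrite /rip !ud.
by rewrite !rip_i !ud.
Qed.

End HilbertSpace.

(** * Self-adjoint operators *)

(** Recursion in which each choice depends on all earlier ones, as for successive eigenvectors. The
    first hypothesis makes [Q n f] read [f] only below [n], so that a finite table can stand for
    [f]. *)
Lemma strong_dependent_choice (T : Type) (x0 : T) (Q : nat -> (nat -> T) -> T -> Prop) :
  (forall n f g x, (forall i, (i < n)%N -> f i = g i) -> Q n f x -> Q n g x) ->
  (forall n f, (forall i, (i < n)%N -> Q i f (f i)) -> exists x, Q n f x) ->
  exists f, forall n, Q n f (f n).
Proof.
move=> Qext Qex.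
pose next n f := match pselect (exists x, Q n f x) with
  | left h => projT1 (cid h) | right _ => x0 end.
(* [g n] is the table of the first [n] choices, padded with the default [x0]. *)
pose g := fix g n := if n is m.+1 then
  fun i => if i == m then next m (g m) else g m i else fun=> x0.
pose f n := next n (g n).
have gf n i : (i < n)%N -> g n i = f i.
  elim: n => // n IH; rewrite ltnS leq_eqVlt /= => /orP[/eqP ->|lt_in].
    by rewrite eqxx.
  by rewrite ltn_eqF // IH.
exists f => n; elim/ltn_ind: n => n IH.
apply: (Qext n (g n)) => [i /gf //|].
have h : exists x, Q n (g n) x.
  apply: Qex => i lt_in; rewrite gf //; apply: (Qext i f) (IH i lt_in) => j lt_ji.
  by rewrite gf // (ltn_trans lt_ji).
by rewrite /f /next; case: pselect => // h'; case: cid.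
Qed.

Section Operators.
Context {R : realType} {H : completeNormedModType R[i]}.
Variable ip : {dot H for (@Num.conj R[i])}.
Hypothesis norm_ip : hilbert_norm ip.
Local Notation rp := (rip ip).

Section LinearOperator.
Variable B : operator H.
Hypothesis linB : linear_operator B.

Lemma dom0 : dom B 0. Proof. by case: linB. Qed.

Lemma op0 : B 0 = 0.
Proof.
have [d0 /(_ 1 0 0 d0 d0)[_]] := linB.
by rewrite !scale1r addr0 => /eqP; rewrite -subr_eq0 opprD addNKr oppr_eq0 => /eqP.
Qed.

Lemma domZ c x : dom B x -> dom B (c *: x).
Proof. by have [d0 + dx] := linB => /(_ c x 0 dx d0)[]; rewrite addr0. Qed.

Lemma opZ c x : dom B x -> B (c *: x) = c *: B x.
Proof. by have [d0 + dx] := linB => /(_ c x 0 dx d0)[_]; rewrite op0 !addr0. Qed.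

Lemma domD x y : dom B x -> dom B y -> dom B (x + y).
Proof. by have [d0 + dx dy] := linB => /(_ 1 x y dx dy)[]; rewrite scale1r. Qed.

Lemma opD x y : dom B x -> dom B y -> B (x + y) = B x + B y.
Proof. by have [d0 + dx dy] := linB => /(_ 1 x y dx dy)[_]; rewrite !scale1r. Qed.

Lemma domN x : dom B x -> dom B (- x).
Proof. by rewrite -scaleN1r; exact: domZ. Qed.

Lemma opN x : dom B x -> B (- x) = - B x.
Proof. by move=> dx; rewrite -scaleN1r opZ // scaleN1r. Qed.

Lemma domB x y : dom B x -> dom B y -> dom B (x - y).
Proof. by move=> dx dy; apply: domD (domN _). Qed.

Lemma opB x y : dom B x -> dom B y -> B (x - y) = B x - B y.
Proof. by move=> dx dy; rewrite opD ?opN //; apply: domN. Qed.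

Lemma dom_sum n (c : nat -> R[i]) (e : nat -> H) :
  (forall i, (i < n)%N -> dom B (e i)) -> dom B (\sum_(0 <= i < n) c i *: e i).
Proof.
elim: n => [|n IH] de; first by rewrite big_geq //; exact: dom0.
rewrite big_nat_recr //=; apply: domD; last by apply: domZ; apply: de.
by apply: IH => i lt_in; apply: de; rewrite ltnS ltnW.
Qed.

Lemma op_sum n (c : nat -> R[i]) (e : nat -> H) :
  (forall i, (i < n)%N -> dom B (e i)) ->
  B (\sum_(0 <= i < n) c i *: e i) = \sum_(0 <= i < n) c i *: B (e i).
Proof.
elim: n => [|n IH] de; first by rewrite !big_geq //; exact: op0.
have de' i : (i < n)%N -> dom B (e i) by move=> lt_in; apply: de; rewrite ltnS ltnW.
rewrite !big_nat_recr //= opD; first by rewrite IH // opZ //; exact: de.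
  exact: dom_sum.
by apply: domZ; apply: de.
Qed.

End LinearOperator.

Section SelfAdjoint.
Variable B : operator H.
Hypothesis saB : selfadjoint ip B.

Lemma selfadjoint_linear : linear_operator B. Proof. by case: saB. Qed.
Let linB := selfadjoint_linear.

Lemma adj x y : dom B x -> dom B y -> ip (B x) y = ip x (B y).
Proof. by case: saB => _ _ /(_ y (B y))[+ _] => h dx dy; apply: h. Qed.

(** Variational arguments yield only real parts; using the hypothesis at [- 'i%C *: x], which is
    again in the domain, supplies the imaginary parts. *)
Lemma selfadjoint_rip u w : (forall x, dom B x -> rp (B x) u = rp x w) ->
  dom B u /\ B u = w.
Proof.
move=> h; have [_ _ sa] := saB; apply/sa => x dx.
apply: ip_eq_rip; first exact: h.
have := h _ (domZ linB (- 'i%C) dx); rewrite (opZ linB) // /rip !ipZl.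
have -> : - 'i%C = ('i%C)^*%C :> R[i] by apply/eqP; rewrite eq_complex /= oppr0 !eqxx.
by rewrite !ipZr.
Qed.

(** The adjoint relation against a fixed [x] is continuous in both [u n] and [B (u n)], so it
    survives the limit, and self-adjointness reads it back as membership in the graph. *)
Lemma selfadjoint_closed (u : nat -> H) l m : (forall n, dom B (u n)) ->
  u @ \oo --> l -> (fun n => B (u n)) @ \oo --> m -> dom B l /\ B l = m.
Proof.
move=> du ul um; apply: selfadjoint_rip => x dx.
rewrite (ripC ip (B x)) (ripC ip x).
have h1 := cvg_rip norm_ip (y := B x) ul; have h2 := cvg_rip norm_ip (y := x) um.
rewrite -(cvg_lim (@norm_hausdorff _ _) h1); apply: cvg_lim; first exact: norm_hausdorff.
have -> // : (fun n => rp (u n) (B x)) = (fun n => rp (B (u n)) x).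
by apply/funext => n; rewrite /rip adj.
Qed.

End SelfAdjoint.

(** First-order condition at a minimum. With k = 1 / (1 + |delta|) the choice t = - beta k leaves
    beta^2 k (k delta - 2), and k delta <= 1 whatever the sign of [delta]. *)
Lemma rip_line_min (beta delta : R) :
  (forall t : R, 0 <= 2 * t * beta + t ^+ 2 * delta) -> beta = 0.
Proof.
move=> h; apply/eqP; rewrite -sqrf_eq0; apply/eqP/le_anti; rewrite sqr_ge0 andbT.
have p0 : 0 < 1 + `|delta| by rewrite ltr_pwDl.
have := h (- beta / (1 + `|delta|)); set k := (1 + `|delta|)^-1.
have k0 : 0 < k by rewrite invr_gt0.
have kE : k * (1 + `|delta|) = 1 by rewrite mulVf ?gt_eqF.
have -> : 2 * (- beta * k) * beta + (- beta * k) ^+ 2 * delta =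
  beta ^+ 2 * k * (k * delta - 2) by ring.
rewrite nmulr_lge0; last first.
  have : k * delta <= k * (1 + `|delta|) by apply: ler_wpM2l; [exact: ltW | rewrite (le_trans (ler_norm _)) // lerDr].
  by rewrite kE => ?; lra.
by rewrite pmulr_lle0.
Qed.

End Operators.

(** * Spectral theorem for operators with compact resolvent *)

Section Orthonormal.
Context {R : realType} {H : completeNormedModType R[i]}.
Variable ip : {dot H for (@Num.conj R[i])}.
Hypothesis norm_ip : hilbert_norm ip.
Local Notation rp := (rip ip).
Variables (e : nat -> H) (n : nat).
Hypothesis orth : forall i j, (i < n)%N -> (j < n)%N -> ip (e i) (e j) = (i == j)%:R.

Definition oproj (m : nat) (x : H) : H := \sum_(0 <= i < m) ip x (e i) *: e i.

Lemma ip_lincomb (c : nat -> R[i]) j : (j < n)%N ->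
  ip (\sum_(0 <= i < n) c i *: e i) (e j) = c j.
Proof.
move=> jn; rewrite ip_suml (bigD1_seq j) ?mem_index_iota ?iota_uniq //=.
rewrite ipZl orth // eqxx mulr1 big_seq_cond big1 ?addr0 // => i.
by rewrite mem_index_iota /= => /andP[lin /negPf ij]; rewrite ipZl orth // ij mulr0.
Qed.

Lemma ip_residual x j : (j < n)%N -> ip (x - oproj n x) (e j) = 0.
Proof. by move=> jn; rewrite ipDl ipNl ip_lincomb // subrr. Qed.

Lemma cnorm_lincomb (c : nat -> R[i]) :
  cnorm (\sum_(0 <= i < n) c i *: e i) ^+ 2 =
  \sum_(0 <= i < n) complex.Re `|c i| ^+ 2.
Proof.
apply: complexI; rewrite -(ipxx norm_ip) ip_sumr rmorph_sum.
apply: eq_big_nat => i /andP[_ lt_in]; rewrite ipZr ip_lincomb //.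
by rewrite -[RHS]/((complex.Re `|c i| ^+ 2)%:C) -normC_sqr sqr_normc mulrC.
Qed.

End Orthonormal.

Section Spectral.
Context {R : realType} {H : completeNormedModType R[i]}.
Variable ip : {dot H for (@Num.conj R[i])}.
Hypothesis norm_ip : hilbert_norm ip.
Local Notation rp := (rip ip).
Variables A B : operator H.
Hypothesis sqrtAB : is_sqrt_of ip A B.
Hypothesis V_compact : compact_embedding (dom B) (fun u => cnorm (B u)) setT (@cnorm R H) id.

Lemma sqrt_selfadjoint : selfadjoint ip B. Proof. by case: sqrtAB. Qed.
Let saB := sqrt_selfadjoint.
Let linB := selfadjoint_linear saB.

Lemma dom_sqrt x : dom A x -> [/\ dom B x, dom B (B x) & B (B x) = A x].
Proof. by have [_ _ /(_ x (A x)) [+ _]] := sqrtAB => h dx; apply: h. Qed.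

Lemma form_eigen (l : R) e y : dom A e -> A e = l%:C *: e -> dom B y ->
  ip (B y) (B e) = l%:C * ip y e.
Proof.
by move=> /dom_sqrt[de dBe BBe] Ae dy; rewrite (adj saB) // BBe Ae ipZrr.
Qed.

(** * Minimisation of the Rayleigh quotient on an orthogonal complement *)

Section RayleighMinimizer.
Variables (e : nat -> H) (n : nat).
Let W : set H := [set y | dom B y /\ forall i, (i < n)%N -> ip y (e i) = 0].

Let W_lin c x y : W x -> W y -> W (c *: x + y).
Proof.
move=> [dx x0] [dy y0]; split; first by apply: (domD linB) => //; apply: (domZ linB).
by move=> i lt_in; rewrite ipDl ipZl x0 // y0 // mulr0 addr0.
Qed.

(** Direct method: a minimising sequence of unit vectors is bounded for [cnorm (B y)], so a
    subsequence converges in [H]. The parallelogram law makes the images under [B] Cauchy as well,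
    and closedness of [B] keeps the limit in [W]. *)
Lemma rayleigh_min : (exists2 y, W y & y != 0) ->
  exists u (m : R), [/\ W u, cnorm u = 1, cnorm (B u) ^+ 2 = m &
    forall y, W y -> m * cnorm y ^+ 2 <= cnorm (B y) ^+ 2].
Proof.
move=> [y0 Wy0 y0_neq0].
have normalize y : W y -> y != 0 -> exists2 z, W z & cnorm z = 1 /\
    cnorm (B y) ^+ 2 = cnorm y ^+ 2 * cnorm (B z) ^+ 2.
  move=> Wy y_neq0; have ny : cnorm y != 0 by rewrite cnorm_eq0.
  exists ((cnorm y)^-1%:C *: y).
    have W0 : W 0 by split; [exact: (dom0 linB) | move=> i _; rewrite ip0l].
    by rewrite -[_ *: _]addr0; exact: W_lin.
  rewrite (opZ linB) //; last by case: Wy.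
  rewrite !cnormZr ger0_norm ?invr_ge0 ?cnorm_ge0 // mulVf //; split=> //.
  by rewrite -exprMn mulrA divff // mul1r.
pose S := [set cnorm (B y) ^+ 2 | y in [set y | W y /\ cnorm y = 1]].
have S_lb : has_lbound S by exists 0 => _ [y _ <-]; rewrite sqr_ge0.
have S_inf : has_inf S.
  by split=> //; have [z Wz [nz _]] := normalize _ Wy0 y0_neq0; exists (cnorm (B z) ^+ 2); exists z.
pose m := inf S.
have low y : W y -> m * cnorm y ^+ 2 <= cnorm (B y) ^+ 2.
  move=> Wy; have [->|y_neq0] := eqVneq y 0; first by rewrite cnorm0 expr0n mulr0 sqr_ge0.
  have [z Wz [nz ->]] := normalize _ Wy y_neq0.
  by rewrite mulrC ler_wpM2l ?sqr_ge0 //; apply: ge_inf => //; exists z.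
have m_ge0 : 0 <= m.
  by apply: lb_le_inf; [case: S_inf | move=> _ [y _ <-]; rewrite sqr_ge0].
have /choice[y hy] : forall k : nat, exists y, [/\ W y, cnorm y = 1 &
    cnorm (B y) ^+ 2 < m + k.+1%:R^-1].
  move=> k; have k0 : 0 < k.+1%:R^-1 :> R by rewrite invr_gt0.
  by have [_ [y [Wy ny] <-] lt_y] := inf_adherent k0 S_inf; exists y.
have [|k [u [k_incr _ yu]]] := V_compact (fun k => let: And3 h _ _ := hy k in proj1 h).
  exists (m + 1) => k; have [_ _ lt_y] := hy k.
  have lt1 : cnorm (B (y k)) ^+ 2 < m + 1.
    by apply: lt_le_trans lt_y _; rewrite lerD2l invf_le1 // ler1n.
  have [le1|lt1'] := lerP (cnorm (B (y k))) 1; first by rewrite (le_trans le1) // lerDr.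
  by apply: ltW; apply: le_lt_trans lt1; rewrite ler_eXnr // ltW.
have k_ge j : (j <= k j)%N by elim: j => // j IH; apply: leq_ltn_trans (k_incr j).
have {}yu : (fun j => y (k j)) @ \oo --> u by apply/cvg_cnormP.
(* Apply [low] to [y i + y j] and the parallelogram law on both sides: two almost minimal vectors
   that are close in [H] have close images under [B]. *)
have y_cauchy i j : cnorm (B (y i) - B (y j)) ^+ 2 <=
    2 * i.+1%:R^-1 + 2 * j.+1%:R^-1 + m * cnorm (y i - y j) ^+ 2.
  have [[di Wi] ni bi] := hy i; have [[dj Wj] nj bj] := hy j.
  have := low (y i + y j); have -> : y i + y j = 1 *: y i + y j by rewrite scale1r.
  move=> /(_ (W_lin _ (conj di Wi) (conj dj Wj))); rewrite scale1r (opD linB) //.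
  have -> : cnorm (y i + y j) ^+ 2 = 4 - cnorm (y i - y j) ^+ 2.
    by rewrite (cnormD_sqr norm_ip) (cnormB_sqr norm_ip) ni nj; ring.
  have -> : cnorm (B (y i) + B (y j)) ^+ 2 = 2 * cnorm (B (y i)) ^+ 2 +
      2 * cnorm (B (y j)) ^+ 2 - cnorm (B (y i) - B (y j)) ^+ 2.
    by rewrite (cnormD_sqr norm_ip) (cnormB_sqr norm_ip); ring.
  have aux (M p q X Y Z D : R) : X < M + p -> Y < M + q ->
    M * (4 - D) <= 2 * X + 2 * Y - Z -> Z <= 2 * p + 2 * q + M * D by lra.
  exact: aux bi bj.
have By_cvg : cvgn (fun j => B (y (k j))).
  apply: hilbert_cauchy_cvg => eps eps0.
  (* This makes m (2 d)^2 at most eps^2 / 4; the two harmonic errors, each below eps^2 / 8 and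
     doubled, contribute less than eps^2 / 2. *)
  pose d := eps / (4 * (1 + m)).
  have d0 : 0 < d by rewrite divr_gt0 // mulr_gt0 // ltr_pwDl.
  move/hilbert_cvgP: yu => /(_ d d0) [N1 hN1].
  have [|N2] := @ltr_add_invr R 0 (eps ^+ 2 / 8); first by rewrite divr_gt0 // exprn_gt0.
  rewrite add0r => hN2; exists (maxn N1 N2) => p q; rewrite geq_max => /andP[N1p N2p] le_pq.
  have inv_lt l : (N2 <= l)%N -> (k l).+1%:R^-1 < eps ^+ 2 / 8.
    move=> N2l; apply: le_lt_trans hN2; rewrite lef_pV2 ?posrE // ler_nat ltnS.
    exact: leq_trans N2l (k_ge l).
  have dpq : cnorm (y (k q) - y (k p)) <= 2 * d.
    have -> : y (k q) - y (k p) = (y (k q) - u) + (u - y (k p)) by rewrite addrA subrK.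
    rewrite (le_trans (cnormD _ _)) // [cnorm (u - _)]cnormBC mulr2n mulrDl !mul1r.
    by rewrite lerD // ltW // hN1 // (leq_trans N1p).
  rewrite -(@ltr_pXn2r _ 2) ?nnegrE ?cnorm_ge0 ?ltW //.
  apply: le_lt_trans (y_cauchy _ _) _.
  have aux (r s D E : R) : r < E / 8 -> s < E / 8 -> D <= E / 4 -> 0 < E ->
    2 * r + 2 * s + D < E by lra.
  apply: (aux _ _ _ _ (inv_lt q (leq_trans N2p le_pq)) (inv_lt p N2p)); last exact: exprn_gt0.
  apply: (@le_trans _ _ (m * (2 * d) ^+ 2)).
      by rewrite ler_wpM2l // ler_pXn2r // nnegrE ?cnorm_ge0 // mulr_ge0 // ltW.
    rewrite /d; set M := (1 + m); have M0 : 0 < M by rewrite ltr_pwDl.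
    have -> : m * (2 * (eps / (4 * M))) ^+ 2 = (m / M ^+ 2) * (eps ^+ 2 / 4).
      by field; rewrite gt_eqF.
    rewrite ler_piMl ?divr_ge0 ?sqr_ge0 // ler_pdivrMr ?exprn_gt0 // mul1r.
    by rewrite (le_trans (_ : m <= M)) ?lerDr // ler_eXnr // lerDl.
pose v := lim ((fun j => B (y (k j))) @ \oo).
have [du Bu] : dom B u /\ B u = v.
  by apply: (selfadjoint_closed norm_ip saB _ yu By_cvg) => j; case: (hy (k j)) => -[].
have Wu : W u.
  split=> // i lt_in; apply: (cvg_ip_eq norm_ip (N := 0) yu) => j _.
  by have [[_ /(_ _ lt_in)]] := hy (k j).
have nu : cnorm u = 1.
  rewrite -(cvg_lim (@norm_hausdorff _ _) (cvg_cnorm yu)); apply: cvg_lim; first exact: norm_hausdorff.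
  have -> : (fun j => cnorm (y (k j))) = fun=> 1 by apply/funext => j; case: (hy (k j)).
  exact: cvg_cst.
exists u, m; split=> //; apply/eqP; rewrite eq_le; apply/andP; split; last first.
  by have := low u Wu; rewrite nu expr1n mulr1.
rewrite Bu; have h := cvg_cnorm By_cvg.
have h2 : (fun j => cnorm (B (y (k j))) ^+ 2) @ \oo --> cnorm v ^+ 2 by exact: (cvgM h h).
have hm : (fun j => m + j.+1%:R^-1) @ \oo --> m + 0.
  by apply: cvgD; [exact: cvg_cst | exact: cvg_harmonic].
rewrite addr0 in hm.
apply: (ler_cvg_to h2 hm); near=> j.
have [_ _ lt_y] := hy (k j); rewrite (le_trans (ltW lt_y)) // lerD2l.
by rewrite lef_pV2 ?posrE // ler_nat ltnS.
Unshelve. all: by end_near.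
Qed.

End RayleighMinimizer.

(** Pairs are (eigenvalue, eigenvector) and [f] lists the earlier ones. The last clause, minimality
    on the complement, is recorded because it later bounds Fourier remainders and so gives
    totality. *)
Definition next_eigen n (f : nat -> R * H) (x : R * H) : Prop :=
  [/\ dom A x.2, A x.2 = x.1%:C *: x.2, cnorm x.2 = 1,
      forall i, (i < n)%N -> ip x.2 (f i).2 = 0 &
      forall y, dom B y -> (forall i, (i < n)%N -> ip y (f i).2 = 0) ->
        x.1 * cnorm y ^+ 2 <= cnorm (B y) ^+ 2].

Lemma next_eigen_orth n f : (forall i, (i < n)%N -> next_eigen i f (f i)) ->
  forall i j, (i < n)%N -> (j < n)%N -> ip (f i).2 (f j).2 = (i == j)%:R.
Proof.
move=> Q i j lt_in lt_jn; have [_ _ ni oi _] := Q i lt_in; have [_ _ _ oj _] := Q j lt_jn.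
have [lt_ij|lt_ji|ij] := ltngtP i j; last by rewrite -ij (ipxx norm_ip) ni expr1n.
  by rewrite ipC oj // conjc0.
by rewrite oi.
Qed.

Hypothesis A_unbounded : unbounded_operator A.

(** The minimiser satisfies an Euler equation on the complement of the earlier eigenvectors. It
    extends to all of [dom B] because [u] is orthogonal to their span both in [H] and for the form
    of [B]; self-adjointness then gives the strong equation. *)
Lemma next_eigen_ex n f : (forall i, (i < n)%N -> next_eigen i f (f i)) ->
  exists x, next_eigen n f x.
Proof.
move=> Q; pose e i := (f i).2.
have orth : forall i j, (i < n)%N -> (j < n)%N -> ip (e i) (e j) = (i == j)%:R.
  exact: next_eigen_orth.
have dAe i : (i < n)%N -> dom A (e i) by case/Q.
have Ae i : (i < n)%N -> A (e i) = (f i).1%:C *: e i by case/Q.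
have dBe i : (i < n)%N -> dom B (e i) by case/dAe/dom_sqrt.
have [|u [m [[du ou] nu Bu low]]] := @rayleigh_min e n.
  (* With a zero complement, every [x] in [dom A] would equal its projection on finitely many
     eigenvectors, and [A] would be bounded. *)
  apply: contrapT => W0; apply: A_unbounded.
  exists (\sum_(0 <= i < n) cnorm (A (e i))) => x dx; have [dBx _ BBx] := dom_sqrt dx.
  have xE : x = oproj ip e n x.
    apply/eqP; rewrite -subr_eq0; apply/negPn/negP => r0; apply: W0.
    exists (x - oproj ip e n x) => //; split; last by move=> i; exact: ip_residual orth _ _.
    by apply: (domB linB) => //; apply: dom_sum.
  have BBe i : (i < n)%N -> B (B (e i)) = A (e i) by move=> /dAe/dom_sqrt[].
  rewrite -BBx xE (op_sum linB) // (op_sum linB); last first.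
    by move=> i /dAe/dom_sqrt[].
  rewrite -xE mulr_suml.
  have -> : \sum_(0 <= i < n) ip x (e i) *: B (B (e i)) = \sum_(0 <= i < n) ip x (e i) *: A (e i).
    by apply: eq_big_nat => i /andP[_ lt_in]; rewrite BBe.
  apply: (@le_trans _ _ (\sum_(0 <= i < n) cnorm (ip x (e i) *: A (e i)))).
    apply: (big_ind2 (fun a b => cnorm a <= b)) => [|a b c d ab cd|//]; first by rewrite cnorm0.
    by rewrite (le_trans (cnormD _ _)) // lerD.
  rewrite big_nat [leRHS]big_nat; apply: ler_sum => i /andP[_ lt_in].
  rewrite cnormZ mulrC ler_wpM2l ?cnorm_ge0 // (le_trans (ip_norm_le norm_ip _ _)) //.
  by have [_ _ -> _ _] := Q i lt_in; rewrite mulr1.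
(* First variation at [u] in the direction [p]: [low] is an equality at [u], so the term linear in
   [t] vanishes. *)
have euler p : dom B p -> (forall i, (i < n)%N -> ip p (e i) = 0) ->
    rp (B u) (B p) - m * rp u p = 0.
  move=> dp op; apply: (@rip_line_min _ _ (cnorm (B p) ^+ 2 - m * cnorm p ^+ 2)) => t.
  have := low (u + t%:C *: p) _; rewrite (opD linB) ?(opZ linB) //; last exact: (domZ linB).
  rewrite 2!(cnormD_sqr norm_ip) !cnormZr !ripZr nu Bu !exprMn !real_normK ?num_real // expr1n.
  move=> h; have {h} := h _; set a := rp _ _; set b := rp _ _ => h.
  have aux (X Y : R) : m * (1 + 2 * (t * a) + t ^+ 2 * X) <=
    m + 2 * (t * b) + t ^+ 2 * Y -> 0 <= 2 * t * (b - m * a) + t ^+ 2 * (Y - m * X).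
    by rewrite -subr_ge0; congr (_ <= _); ring.
  apply: aux; apply: h; split; first by apply: (domD linB) => //; apply: (domZ linB).
  by move=> i lt_in; rewrite ipDl ipZl ou // op // mulr0 addr0.
have [dBu BBu] : dom B (B u) /\ B (B u) = m%:C *: u.
  apply: (selfadjoint_rip saB) => x dx; rewrite ripZr.
  pose r := x - oproj ip e n x.
  have dp : dom B (oproj ip e n x) by apply: (dom_sum linB).
  have dr : dom B r by apply: (domB linB).
  have xE : x = r + oproj ip e n x by rewrite /r subrK.
  have := euler r dr (fun i lt_in => ip_residual orth _ lt_in).
  rewrite (ripC ip u) (ripC ip (B u)) => /eqP; rewrite subr_eq0 => /eqP eur.
  rewrite xE (opD linB) // [rp (B r + _) _]ripDl [rp (r + _) u]ripDl eur.
  have -> : rp (oproj ip e n x) u = 0.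
    rewrite ripC /rip ip_sumr big_nat big1 // => i /andP[_ lt_in].
    by rewrite ipZr ou // mulr0.
  have -> : rp (B (oproj ip e n x)) (B u) = 0.
    rewrite (op_sum linB) // ripC /rip ip_sumr big_nat big1 // => i /andP[_ lt_in].
    by rewrite ipZr (form_eigen (dAe _ lt_in) (Ae _ lt_in)) // ou // !mulr0.
  by rewrite !addr0.
have [dAu Au] : dom A u /\ A u = m%:C *: u.
  by have [_ _ /(_ u (m%:C *: u)) [_]] := sqrtAB; apply.
by exists (m, u); split=> // y dy oy; apply: low.
Qed.

Lemma cnorm_form_eigen (mu : R) e : dom A e -> A e = mu%:C *: e ->
  cnorm (B e) ^+ 2 = mu * cnorm e ^+ 2.
Proof.
move=> de Ae; have [dBe _ _] := dom_sqrt de; apply: complexI.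
by rewrite -(ipxx norm_ip) (form_eigen de Ae dBe) (ipxx norm_ip) -rmorphM.
Qed.

(** Bounded eigenvalues would bound [e] in V, and compactness would give a subsequence converging in
    [H]; but distinct orthonormal vectors are at distance sqrt 2. *)
Lemma eigenvalues_unbounded (mu : nat -> R) (e : nat -> H) :
  (forall n, dom A (e n) /\ A (e n) = (mu n)%:C *: e n) ->
  (forall i j, ip (e i) (e j) = (i == j)%:R) -> forall M, exists n, M < mu n.
Proof.
move=> eig orth M; apply: contrapT => hM.
have ne n : cnorm (e n) ^+ 2 = 1.
  by apply: complexI; rewrite -(ipxx norm_ip) orth eqxx.
have le_mu n : mu n <= M by rewrite leNgt; apply/negP => h; apply: hM; exists n.
have [n|| k [u [k_incr _ /cvg_cnormP/hilbert_cvgP eu]]] := V_compact (x := e).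
- by have [/dom_sqrt[]] := eig n.
- exists (M + 1) => n; have [de Ae] := eig n.
  have := cnorm_form_eigen de Ae; rewrite ne mulr1 => BeE.
  by have := le_mu n; rewrite -BeE; nra.
have half0 : 0 < 2^-1 :> R by rewrite invr_gt0.
have [N hN] := eu _ half0.
have : cnorm (e (k N) - e (k N.+1)) < 1.
  have -> : e (k N) - e (k N.+1) = (e (k N) - u) + (u - e (k N.+1)) by rewrite addrA subrK.
  rewrite (le_lt_trans (cnormD _ _)) // [cnorm (u - _)]cnormBC.
  have := hN N (leqnn N); have := hN N.+1 (leqnSn N); lra.
apply/negP; rewrite -leNgt -(@ler_pXn2r _ 2) ?nnegrE ?cnorm_ge0 // (cnormB_sqr norm_ip) !ne.
by rewrite /rip orth ltn_eqF // mulr0; lra.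
Qed.

Hypothesis V_dense : dense_embedding (dom B) setT (@cnorm R H) id.

(** Totality: if [x] is orthogonal to every [e n], then for [y] in V only the remainder [r] of [y]
    after [n] terms pairs with [x]. Minimality gives mu_n |r|^2 <= |B y|^2, so (y, x) = 0 as mu_n is
    unbounded, and V is dense. *)
Lemma eigenbasis_ex : exists p, is_eigenbasis ip A p.
Proof.
have [||f Qf] := @strong_dependent_choice _ (0, 0) next_eigen.
- move=> n f g x fg [? ? ? ox lx]; split=> // [i lt_in|y dy oy].
    by rewrite -fg // ox.
  by apply: lx => // i lt_in; rewrite fg // oy.
- exact: next_eigen_ex.
pose mu n := (f n).1; pose e n := (f n).2.
have orth i j : ip (e i) (e j) = (i == j)%:R.
  apply: (@next_eigen_orth (maxn i j).+1 f) => [n _||]; first exact: Qf.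
    by rewrite ltnS leq_maxl.
  by rewrite ltnS leq_maxr.
have eig n : dom A (e n) /\ A (e n) = (mu n)%:C *: e n by case: (Qf n).
exists (mu, e); split=> // x /= ox.
have dBe n : dom B (e n) by have [/dom_sqrt[]] := eig n.
have Vx y : dom B y -> rp y x = 0.
  move=> dy; apply/eqP; rewrite -normr_eq0 -sqrf_eq0 -real_normK ?num_real // normr_id.
  rewrite eq_le sqr_ge0 andbT; apply/ler_addgt0Pl => eps eps0; rewrite addr0.
  set C := cnorm (B y) ^+ 2 * cnorm x ^+ 2.
  have C0 : 0 <= C by rewrite mulr_ge0 ?sqr_ge0.
  (* The extra [1] ensures [mu n > 0] even when [C] vanishes. *)
  have [n] := eigenvalues_unbounded eig orth ((1 + C) / eps).
  rewrite ltr_pdivrMr // => mun.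
  pose p := oproj ip e n y; pose r := y - p.
  have dp : dom B p by apply: dom_sum.
  have dr : dom B r by apply: (domB linB).
  have orr i : (i < n)%N -> ip r (e i) = 0.
    by apply: ip_residual => i' j' _ _; exact: orth.
  have [_ _ _ _ /(_ r dr orr) low] := Qf n.
  have Brp : rp (B r) (B p) = 0.
    rewrite (op_sum linB) // /rip ip_sumr big_nat big1 // => i /andP[_ lt_in].
    by have [de Ae] := eig i; rewrite ipZr (form_eigen de Ae dr) orr // !mulr0.
  have By : cnorm (B y) ^+ 2 = cnorm (B r) ^+ 2 + cnorm (B p) ^+ 2.
    rewrite -[in LHS](subrK p y) (opD linB dr dp) (cnormD_sqr norm_ip) Brp.
    by rewrite mulr0 addr0.
  have rE : rp y x = rp r x.
    rewrite -[in LHS](subrK p y) ripDl [X in _ + X](_ : _ = 0) ?addr0 //.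
    rewrite /rip ip_suml big_nat big1 // => i /andP[_ lt_in].
    by rewrite ipZl [ip (e i) x]ipC ox conjc0 mulr0.
  have CS : `|rp y x| ^+ 2 <= cnorm r ^+ 2 * cnorm x ^+ 2.
    rewrite rE -exprMn ler_pXn2r ?nnegrE ?mulr_ge0 ?cnorm_ge0 //.
    exact: cauchy_schwarz.
  apply: (le_trans CS).
  have mu0 : 0 < mu n by rewrite -(pmulr_lgt0 _ eps0); apply: lt_trans mun; lra.
  rewrite -(ler_pM2l mu0) mulrA.
  apply: (@le_trans _ _ C).
    apply: ler_wpM2r; first exact: sqr_ge0.
    by rewrite (le_trans low) // By lerDl sqr_ge0.
  by have := ltW mun; rewrite /mu; lra.
apply/eqP; rewrite -cnorm_eq0 eq_le cnorm_ge0 andbT; apply/ler_addgt0Pl => eps eps0; rewrite addr0.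
have [y dy ny] := V_dense I eps0 (y := x).
have [x0|x0] := leP (cnorm x) 0; first by rewrite (le_trans x0) ?ltW.
rewrite -(ler_pM2r x0) -expr2 (cnorm_sqr norm_ip).
have -> : rp x x = rp (x - y) x by rewrite ripBl (Vx y dy) subr0.
apply: (le_trans (ler_norm _)); apply: (le_trans (cauchy_schwarz norm_ip _ _)).
by rewrite ler_wpM2r ?cnorm_ge0 // cnormBC ltW.
Qed.

End Spectral.

(** Presents a block of a series as a sum starting at 0, the form to which [cnorm_lincomb]
    applies. *)
Lemma sum_nat_maskB (V : zmodType) (f : nat -> V) p q : (p <= q)%N ->
  \sum_(0 <= i < q) (if (i < p)%N then 0 else f i) =
  \sum_(0 <= i < q) f i - \sum_(0 <= i < p) f i.
Proof.
move=> pq; rewrite (big_cat_nat (n := p)) //= [in RHS](big_cat_nat (n := p)) //=.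
rewrite [in RHS]addrAC subrr add0r big_nat_cond big1 ?add0r => [|i /andP[/andP[_ ->]]//].
by apply: eq_big_nat => i /andP[le_pi _]; rewrite ltnNge le_pi.
Qed.

(** * Expansion in the eigenbasis and fractional powers *)

Section EigenBasis.
Context {R : realType} {H : completeNormedModType R[i]}.
Variable ip : {dot H for (@Num.conj R[i])}.
Hypothesis norm_ip : hilbert_norm ip.
Local Notation rp := (rip ip).
Variables (A B : operator H).
Hypothesis sqrtAB : is_sqrt_of ip A B.
Hypothesis B_coercive : exists2 a0 : R, 0 < a0 &
  forall u, dom B u -> cnorm u <= a0 * cnorm (B u).
Variables (mu : nat -> R) (e : nat -> H).
Hypothesis mu_e : is_eigenbasis ip A (mu, e).
Let saB := sqrt_selfadjoint sqrtAB.
Let linB := selfadjoint_linear saB.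

Lemma eigen_dom n : dom A (e n). Proof. by case: mu_e => /(_ n)[]. Qed.

Lemma eigen_op n : A (e n) = (mu n)%:C *: e n. Proof. by case: mu_e => /(_ n)[]. Qed.

Lemma eigen_orth i j : ip (e i) (e j) = (i == j)%:R.
Proof. by case: mu_e => _ /(_ i j). Qed.
Let orth n i j of (i < n)%N & (j < n)%N := eigen_orth i j.

Lemma eigen_total x : (forall n, ip x (e n) = 0) -> x = 0.
Proof. by case: mu_e => _ _; apply. Qed.

Lemma eigen_dom_sqrt n : dom B (e n).
Proof. by have [] := dom_sqrt sqrtAB (eigen_dom n). Qed.

Lemma cnorm_eigen n : cnorm (e n) = 1.
Proof.
apply/eqP; rewrite -(@eqrXn2 _ 2) ?cnorm_ge0 // expr1n; apply/eqP; apply: complexI.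
by rewrite -(ipxx norm_ip) eigen_orth eqxx.
Qed.

(** Coercivity at [e n] reads 1 <= a0 sqrt(mu_n). *)
Lemma eigenvalue_lb : exists2 mu0 : R, 0 < mu0 & forall n, mu0 <= mu n.
Proof.
have [a0 a0_gt0 le_a0] := B_coercive.
exists (a0 ^- 2); first by rewrite invr_gt0 exprn_gt0.
move=> n; have := cnorm_form_eigen norm_ip sqrtAB (eigen_dom n) (eigen_op n).
have := le_a0 _ (eigen_dom_sqrt n); rewrite cnorm_eigen expr1n mulr1 => le1 <-.
by rewrite -exprVn ler_pXn2r ?nnegrE ?invr_ge0 ?cnorm_ge0 ?(ltW a0_gt0) // -div1r ler_pdivrMr // mulrC.
Qed.

Lemma eigenvalue_gt0 n : 0 < mu n.
Proof. by have [mu0 mu0_gt0 /(_ n)] := eigenvalue_lb; apply: lt_le_trans. Qed.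

(* (B - sqrt mu) e is in the kernel of B + sqrt mu, hence zero by positivity. *)
Lemma sqrt_eigen n : B (e n) = (Num.sqrt (mu n))%:C *: e n.
Proof.
have [de dBe BBe] := dom_sqrt sqrtAB (eigen_dom n).
set s := (Num.sqrt (mu n))%:C; pose f := B (e n) - s *: e n.
have df : dom B f by apply: (domB linB) => //; apply: (domZ linB).
have Bf : B f = - (s *: f).
  rewrite /f (opB linB) // ?(opZ linB) //; last exact: (domZ linB).
  rewrite BBe eigen_op scalerBr scalerA opprB -rmorphM -expr2 sqr_sqrtr //.
  exact: ltW (eigenvalue_gt0 n).
have [_ /(_ f df) Bpos _] := sqrtAB.
have s0 : 0 < Num.sqrt (mu n) by rewrite sqrtr_gt0 eigenvalue_gt0.
apply/eqP; rewrite -subr_eq0 -/f -cnorm_eq0 -sqrf_eq0 eq_le sqr_ge0 andbT.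
move: Bpos; rewrite Bf ipNl ipZl (ipxx norm_ip) -rmorphM -rmorphN ler0c oppr_ge0.
by rewrite pmulr_rle0.
Qed.

Lemma ip_sqrt_eigen x n : dom B x -> ip (B x) (e n) = (Num.sqrt (mu n))%:C * ip x (e n).
Proof.
by move=> dx; rewrite (adj saB dx (eigen_dom_sqrt n)) sqrt_eigen ipZrr.
Qed.

Lemma bessel x n : \sum_(0 <= i < n) complex.Re `|ip x (e i)| ^+ 2 <= cnorm x ^+ 2.
Proof.
have pr : rp (x - oproj ip e n x) (oproj ip e n x) = 0.
  rewrite /rip ip_sumr big_nat big1 // => i /andP[_ lt_in].
  by rewrite ipZr (ip_residual (@orth n)) // mulr0.
have := cnormD_sqr norm_ip (x - oproj ip e n x) (oproj ip e n x).
rewrite subrK pr mulr0 addr0 => ->.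
by rewrite (cnorm_lincomb norm_ip (@orth n)) lerDr sqr_ge0.
Qed.

Lemma riesz_fischer (c : nat -> R[i]) (M : R) :
  (forall n, \sum_(0 <= i < n) complex.Re `|c i| ^+ 2 <= M) ->
  cvgn (series (fun i => c i *: e i)).
Proof.
move=> cM; pose u n := \sum_(0 <= i < n) complex.Re `|c i| ^+ 2.
have u_cvg : cvgn u.
  apply: nondecreasing_is_cvgn; last by exists M => _ [n _ <-]; exact: cM.
  apply/nondecreasing_seqP => n; rewrite /u big_nat_recr //= lerDl.
  exact: sqr_ge0.
apply: hilbert_cauchy_cvg => eps eps0.
have /cvgrPdist_lt/(_ (eps ^+ 2 / 2)) := u_cvg; rewrite divr_gt0 ?exprn_gt0 //.
move=> /(_ isT)[N _ hN]; exists N => p q Np pq.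
rewrite -(@ltr_pXn2r _ 2) ?nnegrE ?cnorm_ge0 ?ltW //.
have -> : series (fun i => c i *: e i) q - series (fun i => c i *: e i) p =
    \sum_(0 <= i < q) (if (i < p)%N then 0 else c i) *: e i.
  rewrite /series /= -sum_nat_maskB //; apply: eq_bigr => i _.
  by case: ifP => //; rewrite scale0r.
rewrite (cnorm_lincomb norm_ip (@orth q)).
have -> : \sum_(0 <= i < q) complex.Re `|if (i < p)%N then 0 else c i| ^+ 2 = u q - u p.
  rewrite /u -sum_nat_maskB //; apply: eq_bigr => i _.
  by case: ifP => //; rewrite normr0 expr0n.
have := hN p Np; have := hN q (leq_trans Np pq); rewrite /= !ltr_norml.
by move=> /andP[h1 h2] /andP[h3 h4]; lra.
Qed.

Lemma ip_series (c : nat -> R[i]) n : cvgn (series (fun i => c i *: e i)) ->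
  ip (limn (series (fun i => c i *: e i))) (e n) = c n.
Proof.
move=> sc; apply: (cvg_ip_eq norm_ip (N := n.+1) sc) => k nk.
exact: ip_lincomb (@orth k) _ _ nk.
Qed.

(** Bessel and Riesz-Fischer provide a limit with the same coefficients as [x]; totality identifies
    the two. *)
Lemma fourier_cvg x : (fun n => oproj ip e n x) @ \oo --> x.
Proof.
have sc := riesz_fischer (bessel x).
have {2}-> : x = limn (series (fun i => ip x (e i) *: e i)); last exact: sc.
apply/eqP; rewrite -subr_eq0; apply/eqP; apply: eigen_total => n.
by rewrite ipDl ipNl ip_series // subrr.
Qed.

Lemma powR_le_of_lb (mu0 m s : R) : 0 < mu0 -> mu0 <= m -> s <= 0 -> m `^ s <= mu0 `^ s.
Proof.
move=> mu00 le_m s0; have m0 := lt_le_trans mu00 le_m.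
rewrite -[s]opprK (powRN m) (powRN mu0) lef_pV2 ?posrE ?powR_gt0 //.
by rewrite ge0_ler_powR ?nnegrE ?oppr_ge0 // ltW.
Qed.

Hypothesis basisE : eigenbasis ip A = (mu, e).

Lemma fpow_seriesE s x : fpow_series ip A s x =
  series (fun n => ((mu n `^ s)%:C * ip x (e n)) *: e n).
Proof. by rewrite /fpow_series basisE. Qed.

(** mu^(2s) |(x, e_n)|^2 equals mu^(2s-1) |(B x, e_n)|^2, and mu^(2s-1) is bounded because 2s - 1 <=
    0 and the eigenvalues stay away from 0. *)
Lemma fpow_cvg s x : s <= 2^-1 -> dom B x -> cvgn (fpow_series ip A s x).
Proof.
move=> s_le dx; have [mu0 mu0_gt0 le_mu] := eigenvalue_lb.
rewrite fpow_seriesE; set K := mu0 `^ (2 * s - 1).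
apply: (@riesz_fischer _ (K * cnorm (B x) ^+ 2)) => n.
apply: le_trans (_ : \sum_(0 <= i < n) K * complex.Re `|ip (B x) (e i)| ^+ 2 <= _); last first.
  by rewrite -mulr_sumr ler_wpM2l ?powR_ge0 ?bessel.
apply: ler_sum => i _; have mui := eigenvalue_gt0 i.
rewrite ip_sqrt_eigen // !Re_normMr !exprMn [leRHS]mulrA; apply: ler_wpM2r; first exact: sqr_ge0.
rewrite !real_normK ?num_real // sqr_sqrtr; last exact: ltW.
have -> : (mu i `^ s) ^+ 2 = mu i `^ (2 * s - 1) * mu i.
  rewrite -powR_mulrn ?powR_ge0 // -powRrM -[X in _ = _ * X]powRr1 ?ltW // -powRD.
    by congr (_ `^ _); ring.
  by apply/implyP => _; rewrite gt_eqF.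
rewrite ler_pM2r // powR_le_of_lb //; lra.
Qed.

Lemma ip_fpow s x n : s <= 2^-1 -> dom B x ->
  ip (fpow ip A s x) (e n) = (mu n `^ s)%:C * ip x (e n).
Proof.
move=> s_le dx; have := fpow_cvg s_le dx; rewrite /fpow /= fpow_seriesE => h.
exact: ip_series.
Qed.

Lemma fpow_eigen s (c : R[i]) n : fpow ip A s (c *: e n) = (mu n `^ s)%:C *: (c *: e n).
Proof.
rewrite /fpow /= fpow_seriesE; apply: cvg_lim; first exact: norm_hausdorff.
apply: cvg_near_cst; exists n.+1 => // k /= nk.
rewrite /series /= (bigD1_seq n) ?mem_index_iota ?iota_uniq //= big1 ?addr0.
  by rewrite ipZl eigen_orth eqxx mulr1 scalerA.
by move=> i /negPf ni; rewrite ipZl eigen_orth eq_sym ni !mulr0 scale0r.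
Qed.

Lemma powR_half_sqr (m th : R) : 0 < m -> (m `^ (th / 2))%:C * (m `^ (th / 2))%:C = (m `^ th)%:C.
Proof.
move=> m0; rewrite -rmorphM -powRD; last by apply/implyP => _; rewrite gt_eqF.
by congr ((_ `^ _)%:C); field.
Qed.

(** Tested on an eigenvector, the V'-valued A^theta becomes a scalar. The bound on [th] gives th / 2
    <= 1/2, so that [fpow_cvg] covers all of V. *)
Lemma fpow_dual_eigenr th x (c : R[i]) n : th <= 1 -> dom B x ->
  fpow_dual ip A th x (c *: e n) = (mu n `^ th)%:C * ip x (c *: e n).
Proof.
move=> th1 dx; rewrite /fpow_dual fpow_eigen ipZrr !ipZr ip_fpow //; last by lra.
by rewrite [X in _ * X = _]mulrCA [LHS]mulrA powR_half_sqr ?eigenvalue_gt0.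
Qed.

Lemma fpow_dual_eigenl th x (c : R[i]) n : th <= 1 -> dom B x ->
  fpow_dual ip A th (c *: e n) x = (mu n `^ th)%:C * ip (c *: e n) x.
Proof.
move=> th1 dx; rewrite /fpow_dual (ipC ip) (ipC ip (c *: _)).
have := fpow_dual_eigenr c n th1 dx; rewrite /fpow_dual => ->.
by rewrite rmorphM -[in RHS](conjc_real (_ `^ _)).
Qed.

End EigenBasis.

(** * The damped pair of oscillators *)

Section Gronwall.
Context {R : realType}.

(** f(t) exp(r t) is nonincreasing. At 0 only a right limit is assumed, since that is all an orbit
    provides there. *)
Lemma gronwall (f df : R -> R) (r : R) :
  (forall t : R, 0 < t -> is_derive t 1 f (df t)) -> f x @[x --> 0^'+] --> f 0 ->
  (forall t : R, 0 < t -> df t <= - (r * f t)) ->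
  forall t : R, 0 <= t -> f t <= f 0 * expR (- (r * t)).
Proof.
move=> fdf f0 df_le t; rewrite le_eqVlt => /orP[/eqP <-|t0].
  by rewrite mulr0 oppr0 expR0 mulr1.
pose g (x : R) := f x * expR (r * x).
have dg (x : R) : 0 < x -> is_derive x 1 g ((df x + r * f x) * expR (r * x)).
  move=> x0; have dfx := fdf x x0.
  have dl : is_derive x 1 (fun y : R => r * y) r.
    have -> : (fun y : R => r * y) = r *: (@id R) by apply/funext => y.
    by apply: is_derive_eq; rewrite /GRing.scale /= mulr1.
  have de : is_derive x 1 (fun y : R => expR (r * y)) (r *: expR (r * x)).
    by apply: is_derive_eq; rewrite mulrC.
  have -> : g = f * (fun y => expR (r * y)) by [].
  by apply: is_derive_eq; rewrite /GRing.scale /=; ring.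
have g_le : g t <= g 0.
  apply: (@ler0_derive1_le_cc _ g 0 t) => //; rewrite ?in_itv /= ?lexx ?(ltW t0) //.
  - by move=> x; rewrite in_itv /= => /andP[x0 _]; have [] := dg x x0.
  - move=> x; rewrite in_itv /= => /andP[x0 _]; rewrite derive1E.
    have [_ ->] := dg x x0; rewrite pmulr_lle0 ?expR_gt0 //.
    by have := df_le x x0; lra.
  - apply/(continuous_within_itvP _ t0); split.
    + move=> x; rewrite in_itv /= => /andP[x0 _].
      by apply/differentiable_continuous/derivable1_diffP; have [] := dg x x0.
    + apply: cvgM => //; apply: cvg_at_right_filter.
      apply: continuous_comp; last exact: continuous_expR.
      by apply: cvgM; [exact: cvg_cst | exact: cvg_id].
    + apply: cvg_at_left_filter.
      by apply/differentiable_continuous/derivable1_diffP; have [] := dg t t0.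
move: g_le; rewrite /g mulr0 expR0 mulr1 => h.
by rewrite expRN -[leRHS]/(_ / _) ler_pdivlMr ?expR_gt0.
Qed.

Lemma gronwall_ge (f df : R -> R) (r : R) :
  (forall t : R, 0 < t -> is_derive t 1 f (df t)) -> f x @[x --> 0^'+] --> f 0 ->
  (forall t : R, 0 < t -> - (r * f t) <= df t) ->
  forall t : R, 0 <= t -> f 0 * expR (- (r * t)) <= f t.
Proof.
move=> fdf f0 df_ge t t0.
have := @gronwall (- f) (- df) r; rewrite -lerN2 => h.
have {h} := h _ _ _ t t0; rewrite fctE mulNr; apply.
- by move=> x x0; have := fdf x x0 => ?; exact: is_deriveN.
- exact: cvgN.
- by move=> x x0; rewrite !fctE mulrN lerN2 df_ge.
Qed.
End Gronwall.

Section DeriveFun.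
Context {R : realType}.
Implicit Types (f g : R -> R) (t c : R).

Lemma is_derive_add f g df dg t : is_derive t 1 f df -> is_derive t 1 g dg ->
  is_derive t 1 (fun x => f x + g x) (df + dg).
Proof. by move=> hf hg; exact: is_deriveD. Qed.

Lemma is_derive_mul f g df dg t : is_derive t 1 f df -> is_derive t 1 g dg ->
  is_derive t 1 (fun x => f x * g x) (df * g t + f t * dg).
Proof.
move=> hf hg; have h := is_deriveM hf hg.
by apply: (is_derive_eq h); rewrite /GRing.scale /=; ring.
Qed.

Lemma is_derive_cmul f df t c : is_derive t 1 f df ->
  is_derive t 1 (fun x => c * f x) (c * df).
Proof. by move=> hf; exact: is_deriveZ. Qed.

End DeriveFun.

(** * Lyapunov function of one real pair of oscillators *)

Section Lyapunov.
Context {R : realType}.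
Variables (a b : R).
Hypotheses (a_gt0 : 0 < a) (b_gt0 : 0 < b) (a_neq_b : a <> b).

(* Chosen so that lyap1^2 = lyap2 / 4 and (a + b) lyap2 = lyap1 / 4. *)
Definition lyap1 : R := (16 * (a + b))^-1.
Definition lyap2 : R := (64 * (a + b) ^+ 2)^-1.
Let k1 := lyap1.
Let k2 := lyap2.

(* U and W stand for sqrt(mu) times the modal coefficients of u and w. *)
Definition modal_energy (U v W z : R) : R := a * U ^+ 2 + v ^+ 2 + b * W ^+ 2 + z ^+ 2.

(** The derivatives of the three terms yield - om P^2, - om k1 q^2 and - om k2 Q^2. The second also
    creates k1 om P Q and the third k2 (a + b) om q^2; the two relations between [lyap1] and [lyap2]
    are what lets the earlier squares absorb these. *)
Definition modal_cross (s P q Q : R) : R := s * P - lyap1 * (P * q) + lyap2 * (q * Q).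

(** Young's inequality by completing a square: a product of [s] with an undamped quantity [X] is
    split between the dissipation d s^2 and a small share of rho X^2. *)
Lemma weighted_amgm (al rho d w c s X : R) : 0 < al -> 0 < rho -> w ^+ 2 <= rho * d ->
  c * (w * (s * X)) <= al / 4 * (rho * X ^+ 2) + c ^+ 2 / al * (d * s ^+ 2).
Proof.
move=> al0 rho0 w2; have ar : 0 < al * rho by rewrite mulr_gt0.
rewrite -subr_ge0 -(pmulr_rge0 _ ar).
apply: (@le_trans _ _ ((al * rho * X / 2 - c * w * s) ^+ 2)); first exact: sqr_ge0.
rewrite -subr_ge0.
have -> : al * rho * (al / 4 * (rho * X ^+ 2) + c ^+ 2 / al * (d * s ^+ 2) -
  c * (w * (s * X))) - (al * rho * X / 2 - c * w * s) ^+ 2 =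
  (c * s) ^+ 2 * (rho * d - w ^+ 2) by field; rewrite gt_eqF.
by rewrite mulr_ge0 ?sqr_ge0 // subr_ge0.
Qed.

Lemma lyap1_gt0 : 0 < k1. Proof. by rewrite invr_gt0 mulr_gt0 // addr_gt0. Qed.
Lemma lyap2_gt0 : 0 < k2. Proof. by rewrite invr_gt0 mulr_gt0 // exprn_gt0 // addr_gt0. Qed.

(** Sum of the Young constants c^2 / al for the products s P, s q and s Q, with al = 1, k1, k2. *)
Definition lyapC : R :=
  (k1 * (a + b) - 2) ^+ 2 + (1 - k2 * (a * b)) ^+ 2 / k1 + (- (k2 * (a + b))) ^+ 2 / k2.

(* The left-hand side is the derivative of [modal_cross] along the flow
   s' = - om P - 2 d s, P' = om q, q' = - om Q - (a + b) d s,
   Q' = om ((a + b) q - a b s). *)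
Lemma modal_cross_dissipation (d om eta s P q Q : R) :
  0 < d -> 0 < om -> 0 < eta -> eta * d <= om -> eta * om <= d ->
  eta * ((- om * P - 2 * d * s) * P + s * (om * q)
    - k1 * (om * q * q + P * (- om * Q - (a + b) * d * s))
    + k2 * ((- om * Q - (a + b) * d * s) * Q + q * (om * ((a + b) * q - a * b * s)))) <=
  lyapC * (d * s ^+ 2) -
  (eta * om) / 2 * (P ^+ 2 + k1 * q ^+ 2 + k2 * Q ^+ 2).
Proof.
move=> d0 om0 eta0 ed eo; set rho := eta * om.
have rho0 : 0 < rho by rewrite mulr_gt0.
(* The products with [s] carry the weights eta d (for P and Q) and rho (for q); the two conditions
   on [eta] bound the square of each by rho d. *)
have w1 : (eta * d) ^+ 2 <= rho * d.
  have -> : rho * d = (eta * d) * om by rewrite /rho; ring.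
  by rewrite expr2 ler_wpM2l // mulr_ge0 // ltW.
have w2 : rho ^+ 2 <= rho * d by rewrite expr2; apply: ler_wpM2l => //; exact: ltW.
have h1 := weighted_amgm (k1 * (a + b) - 2) s P ltr01 rho0 w1.
have h2 := weighted_amgm (1 - k2 * (a * b)) s q lyap1_gt0 rho0 w2.
have h3 := weighted_amgm (- (k2 * (a + b))) s Q lyap2_gt0 rho0 w1.
have ab0 : a + b != 0 by rewrite gt_eqF // addr_gt0.
have h4 : k1 * (rho * (P * Q)) <= rho * (P ^+ 2 / 4 + k2 / 4 * Q ^+ 2).
  rewrite -subr_ge0; have -> : rho * (P ^+ 2 / 4 + k2 / 4 * Q ^+ 2) - k1 * (rho * (P * Q)) =
    rho * (P / 2 - k1 * Q) ^+ 2 by rewrite /k1 /k2 /lyap1 /lyap2; field.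
  by rewrite mulr_ge0 ?sqr_ge0 // ltW.
have h5 : k2 * (a + b) = k1 / 4 by rewrite /k1 /k2 /lyap1 /lyap2; field.
have h6 : k2 * (a + b) * (rho * q ^+ 2) = k1 / 4 * (rho * q ^+ 2) by rewrite h5.
(* Each of rho P^2, rho k1 q^2 and rho k2 Q^2 gives up two quarters: P to [h1] and [h4], q to [h2]
   and [h6], Q to [h3] and [h4]. Half of each is left. *)
move: h1 h2 h3 h4 h6; rewrite /lyapC -/rho /rho; clear; move: k1 k2 => x y; rewrite divr1.
move: (x^-1) (y^-1) => x' y'; lra.
Qed.

(** Comes from |x y| <= (x^2 + y^2) / 2 and the bounds s^2 <= 2 E, P^2 <= (a+b) E, q^2 <= (a+b)^2 E,
    Q^2 <= (a+b)^3 E. *)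
Definition crossC : R :=
  (2 + (a + b)) / 2 + k1 * ((a + b) + (a + b) ^+ 2) / 2 + k2 * ((a + b) ^+ 2 + (a + b) ^+ 3) / 2.

Lemma modal_energy_ge0 U v W z : 0 <= modal_energy U v W z.
Proof. by rewrite !(addr_ge0, sqr_ge0, mulr_ge0) // ltW. Qed.

Lemma modal_cross_bound U v W z :
  `|modal_cross (v + z) (a * U + b * W) (a * v + b * z) (a ^+ 2 * U + b ^+ 2 * W)| <=
  crossC * modal_energy U v W z.
Proof.
pose A := a + b; set E := modal_energy U v W z.
have a0 := ltW a_gt0; have b0 := ltW b_gt0; have ab0 := mulr_ge0 a0 b0.
have [k10 k20] := (ltW lyap1_gt0, ltW lyap2_gt0).
set s := v + z; set P := a * U + b * W; set q := a * v + b * z; set Q := a ^+ 2 * U + b ^+ 2 * W.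
have hs : s ^+ 2 <= 2 * E.
  rewrite -subr_ge0; have -> : 2 * E - s ^+ 2 = (v - z) ^+ 2 + 2 * (a * U ^+ 2) + 2 * (b * W ^+ 2).
    by rewrite /E /s /modal_energy; ring.
  by rewrite !(addr_ge0, sqr_ge0, mulr_ge0).
have hP : P ^+ 2 <= A * E.
  rewrite -subr_ge0; have -> : A * E - P ^+ 2 = a * b * (U - W) ^+ 2 + A * (v ^+ 2 + z ^+ 2).
    by rewrite /E /P /A /modal_energy; ring.
  by rewrite !(addr_ge0, sqr_ge0, mulr_ge0).
have hq : q ^+ 2 <= A ^+ 2 * E.
  rewrite -subr_ge0; have -> : A ^+ 2 * E - q ^+ 2 =
      a ^+ 2 * z ^+ 2 + b ^+ 2 * v ^+ 2 + a * b * (v - z) ^+ 2 + a * b * (v ^+ 2 + z ^+ 2)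
      + A ^+ 2 * (a * U ^+ 2 + b * W ^+ 2).
    by rewrite /E /q /A /modal_energy; ring.
  by rewrite !(addr_ge0, sqr_ge0, mulr_ge0).
have hQ : Q ^+ 2 <= A ^+ 3 * E.
  rewrite -subr_ge0; have -> : A ^+ 3 * E - Q ^+ 2 =
      a * b * (3 * a + 3 * b) * (a * U ^+ 2 + b * W ^+ 2) + a * b * (a * W - b * U) ^+ 2
      + A ^+ 3 * (v ^+ 2 + z ^+ 2).
    by rewrite /E /Q /A /modal_energy; ring.
  by rewrite !(addr_ge0, sqr_ge0, mulr_ge0).
have amgm (x y : R) : `|x * y| <= (x ^+ 2 + y ^+ 2) / 2.
  rewrite ler_norml; apply/andP; split; rewrite -subr_ge0.
    by have := sqr_ge0 (x + y); rewrite sqrrD; lra.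
  by have := sqr_ge0 (x - y); rewrite sqrrB; lra.
rewrite /modal_cross /crossC -/A.
apply: (@le_trans _ _ (`|s * P| + k1 * `|P * q| + k2 * `|q * Q|)).
  rewrite -[X in _ + X * _ + _]ger0_norm // -[X in _ + X * `|q * Q|]ger0_norm //.
  rewrite -!normrM; apply: (le_trans (ler_normD _ _)); rewrite lerD2r.
  exact: ler_normB.
apply: (@le_trans _ _ ((s ^+ 2 + P ^+ 2) / 2 + k1 * ((P ^+ 2 + q ^+ 2) / 2) +
    k2 * ((q ^+ 2 + Q ^+ 2) / 2))).
  by rewrite !lerD // ler_wpM2l.
have h1 : k1 * (P ^+ 2 + q ^+ 2) <= k1 * (A * E + A ^+ 2 * E) by rewrite ler_wpM2l // lerD.
have h2 : k2 * (q ^+ 2 + Q ^+ 2) <= k2 * (A ^+ 2 * E + A ^+ 3 * E) by rewrite ler_wpM2l // lerD.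
by lra.
Qed.

(** Here a <> b enters: (s, q) in terms of (v, z) and (P, Q) in terms of (a U, b W) are Vandermonde
    systems with nodes a, b, hence invertible. *)
Lemma modal_energy_bound : exists2 C : R, 0 < C & forall U v W z,
  modal_energy U v W z <= C * ((v + z) ^+ 2 + ((a * U + b * W) ^+ 2 +
    k1 * (a * v + b * z) ^+ 2 + k2 * (a ^+ 2 * U + b ^+ 2 * W) ^+ 2)).
Proof.
have dl : 0 < (a - b) ^+ 2.
  by rewrite lt0r sqr_ge0 andbT sqrf_eq0 subr_eq0; apply/eqP.
have [k10 k20] := (lyap1_gt0, lyap2_gt0).
pose C := 2 * (a ^+ 2 + b ^+ 2) + 2 * (b ^+ 2 / a + a ^+ 2 / b) + 4 / k1 + (2 / a + 2 / b) / k2.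
have a20 : 0 < a ^+ 2 by rewrite exprn_gt0. have b20 : 0 < b ^+ 2 by rewrite exprn_gt0.
have [c1 c2 c3 c4] : [/\ 0 < 2 * (a ^+ 2 + b ^+ 2), 0 < 2 * (b ^+ 2 / a + a ^+ 2 / b),
    0 < 4 / k1 & 0 < (2 / a + 2 / b) / k2].
  by split; rewrite ?(divr_gt0, addr_gt0, mulr_gt0).
exists (C / (a - b) ^+ 2); first by rewrite divr_gt0 // !addr_gt0.
move=> U v W z; rewrite mulrAC ler_pdivlMr //.
set s := v + z; set P := a * U + b * W; set q := a * v + b * z; set Q := a ^+ 2 * U + b ^+ 2 * W.
(* Uses q - b s = (a - b) v and a s - q = (a - b) z; for [hU] below, Q - b P = a (a - b) U and a P -
   Q = b (a - b) W. *)
have hv : (a - b) ^+ 2 * (v ^+ 2 + z ^+ 2) <= 2 * (a ^+ 2 + b ^+ 2) * s ^+ 2 + 4 * q ^+ 2.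
  rewrite -subr_ge0; have -> : 2 * (a ^+ 2 + b ^+ 2) * s ^+ 2 + 4 * q ^+ 2 - (a - b) ^+ 2 * (v ^+ 2 + z ^+ 2)
    = (q + b * s) ^+ 2 + (q + a * s) ^+ 2 by rewrite /q /s; ring.
  by rewrite addr_ge0 ?sqr_ge0.
have hU : (a - b) ^+ 2 * (a * U ^+ 2 + b * W ^+ 2) <=
    2 * (b ^+ 2 / a + a ^+ 2 / b) * P ^+ 2 + (2 / a + 2 / b) * Q ^+ 2.
  rewrite -subr_ge0; have -> : 2 * (b ^+ 2 / a + a ^+ 2 / b) * P ^+ 2 + (2 / a + 2 / b) * Q ^+ 2
      - (a - b) ^+ 2 * (a * U ^+ 2 + b * W ^+ 2)
    = (Q + b * P) ^+ 2 / a + (a * P + Q) ^+ 2 / b.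
    by rewrite /Q /P; field; rewrite !gt_eqF.
  by rewrite addr_ge0 ?divr_ge0 ?sqr_ge0 // ltW.
have -> : modal_energy U v W z * (a - b) ^+ 2 =
    (a - b) ^+ 2 * (v ^+ 2 + z ^+ 2) + (a - b) ^+ 2 * (a * U ^+ 2 + b * W ^+ 2).
  by rewrite /modal_energy; ring.
apply: (le_trans (lerD hv hU)).
have e1 : 4 * q ^+ 2 = 4 / k1 * (k1 * q ^+ 2) by field; rewrite gt_eqF.
have e2 : (2 / a + 2 / b) * Q ^+ 2 = (2 / a + 2 / b) / k2 * (k2 * Q ^+ 2).
  by rewrite [in RHS]mulrA divfK // gt_eqF.
rewrite e1 e2.
have x1 := sqr_ge0 s; have x2 := sqr_ge0 P.
have x3 : 0 <= k1 * q ^+ 2 by rewrite mulr_ge0 ?sqr_ge0 // ltW.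
have x4 : 0 <= k2 * Q ^+ 2 by rewrite mulr_ge0 ?sqr_ge0 // ltW.
move: c1 c2 c3 c4 x1 x2 x3 x4; rewrite /C; clear.
move: (2 * (_ + _)) (2 * (_ + _)) (4 / _) (_ / k2) (s ^+ 2) (P ^+ 2) (k1 * _) (k2 * _).
move=> C1 C2 C3 C4 y1 y2 y3 y4 c1 c2 c3 c4 x1 x2 x3 x4.
have m x y : 0 < x -> 0 <= y -> 0 <= x * y :> R by move=> ? ?; rewrite mulr_ge0 // ltW.
have := m _ _ c1 x2; have := m _ _ c1 x3; have := m _ _ c1 x4.
have := m _ _ c2 x1; have := m _ _ c2 x3; have := m _ _ c2 x4.
have := m _ _ c3 x1; have := m _ _ c3 x2; have := m _ _ c3 x4.
have := m _ _ c4 x1; have := m _ _ c4 x2; have := m _ _ c4 x3.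
by lra.
Qed.

Definition modal_flow (d om : R) (U V W Z : R -> R) : Prop :=
  (forall t : R, 0 < t ->
    [/\ is_derive t 1 U (om * V t), is_derive t 1 W (om * Z t),
        is_derive t 1 V (- (a * om * U t) - d * (V t + Z t)) &
        is_derive t 1 Z (- (b * om * W t) - d * (V t + Z t))]) /\
  [/\ U x @[x --> 0^'+] --> U 0, V x @[x --> 0^'+] --> V 0,
      W x @[x --> 0^'+] --> W 0 & Z x @[x --> 0^'+] --> Z 0].

(** [C] and [c] are fixed before [d] and [om], hence common to all modes; this is what allows
    summation over the modes. *)
Definition uniform_modal_decay (C c : R) : Prop :=
  forall d om U V W Z, 0 < d -> 0 < om -> modal_flow d om U V W Z ->
  forall t : R, 0 <= t ->
  modal_energy (U t) (V t) (W t) (Z t) <=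
  C * modal_energy (U 0) (V 0) (W 0) (Z 0) * expR (- (c * Num.min d (om ^+ 2 / d) * t)).

Section ModalFlow.
Variables (d om : R) (U V W Z : R -> R).
Hypotheses (d_gt0 : 0 < d) (om_gt0 : 0 < om) (flow : modal_flow d om U V W Z).
Let E (t : R) := modal_energy (U t) (V t) (W t) (Z t).

Lemma modal_energy_derive (t : R) : 0 < t -> is_derive t 1 E (- (2 * d * (V t + Z t) ^+ 2)).
Proof.
move=> /(proj1 flow)[dU dW dV dZ].
have -> : E = fun x => a * (U x * U x) + V x * V x + b * (W x * W x) + Z x * Z x.
  by apply/funext => x; rewrite /E /modal_energy !expr2.
have h := is_derive_add (is_derive_add (is_derive_add (is_derive_cmul a (is_derive_mul dU dU))
  (is_derive_mul dV dV)) (is_derive_cmul b (is_derive_mul dW dW))) (is_derive_mul dZ dZ).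
by apply: (is_derive_eq h); ring.
Qed.

Lemma modal_energy_cvg0 : E x @[x --> 0^'+] --> E 0.
Proof.
have [_ [hU hV hW hZ]] := flow.
apply: (cvgD (cvgD (cvgD (cvgM (cvg_cst _) (cvgM hU hU)) (cvgM hV hV))
  (cvgM (cvg_cst _) (cvgM hW hW))) (cvgM hZ hZ)).
Qed.

(** (v + z)^2 <= 2 (v^2 + z^2) <= 2 E, so the energy cannot be dissipated faster than at rate 4
    d. *)
Lemma modal_energy_lower (t : R) : 0 <= t -> E 0 * expR (- (4 * d * t)) <= E t.
Proof.
apply: (gronwall_ge modal_energy_derive modal_energy_cvg0) => x _.
rewrite lerN2.
have -> : 4 * d * E x = 2 * d * (V x + Z x) ^+ 2 + 2 * d * ((V x - Z x) ^+ 2 +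
    2 * a * U x ^+ 2 + 2 * b * W x ^+ 2) by rewrite /E /modal_energy; ring.
have [[a0 b0] d0] := (ltW a_gt0, ltW b_gt0, ltW d_gt0).
rewrite lerDl; apply: mulr_ge0; first exact: mulr_ge0.
apply: addr_ge0; [apply: addr_ge0; first exact: sqr_ge0|];
  by apply: mulr_ge0; [exact: mulr_ge0 | exact: sqr_ge0].
Qed.

Let F (t : R) := modal_cross (V t + Z t) (a * U t + b * W t) (a * V t + b * Z t)
  (a ^+ 2 * U t + b ^+ 2 * W t).

Lemma modal_cross_derive (t : R) : 0 < t ->
  let s := V t + Z t in let P := a * U t + b * W t in
  let q := a * V t + b * Z t in let Q := a ^+ 2 * U t + b ^+ 2 * W t in
  is_derive t 1 F ((- om * P - 2 * d * s) * P + s * (om * q)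
    - k1 * (om * q * q + P * (- om * Q - (a + b) * d * s))
    + k2 * ((- om * Q - (a + b) * d * s) * Q + q * (om * ((a + b) * q - a * b * s)))).
Proof.
move=> /(proj1 flow)[dU dW dV dZ] s P q Q.
have ds := is_derive_add dV dZ.
have dP := is_derive_add (is_derive_cmul a dU) (is_derive_cmul b dW).
have dq := is_derive_add (is_derive_cmul a dV) (is_derive_cmul b dZ).
have dQ := is_derive_add (is_derive_cmul (a ^+ 2) dU) (is_derive_cmul (b ^+ 2) dW).
have -> : F = fun x => (V x + Z x) * (a * U x + b * W x) +
    (- k1) * ((a * U x + b * W x) * (a * V x + b * Z x)) +
    k2 * ((a * V x + b * Z x) * (a ^+ 2 * U x + b ^+ 2 * W x)).
  by apply/funext => x; rewrite mulNr.
have h := is_derive_add (is_derive_add (is_derive_mul ds dP)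
  (is_derive_cmul (- k1) (is_derive_mul dP dq))) (is_derive_cmul k2 (is_derive_mul dq dQ)).
by apply: (is_derive_eq h); rewrite /s /P /q /Q; ring.
Qed.

Lemma modal_cross_cvg0 : F x @[x --> 0^'+] --> F 0.
Proof.
have [_ [hU hV hW hZ]] := flow.
have lin (x y : R) (f g : R -> R) : f x @[x --> 0^'+] --> f 0 -> g x @[x --> 0^'+] --> g 0 ->
    x * f t + y * g t @[t --> 0^'+] --> x * f 0 + y * g 0.
  by move=> hf hg; apply: (cvgD (cvgM (cvg_cst _) hf) (cvgM (cvg_cst _) hg)).
apply: (cvgD (cvgB (cvgM (cvgD hV hZ) (lin _ _ _ _ hU hW))
  (cvgM (cvg_cst _) (cvgM (lin _ _ _ _ hU hW) (lin _ _ _ _ hV hZ))))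
  (cvgM (cvg_cst _) (cvgM (lin _ _ _ _ hV hZ) (lin _ _ _ _ hU hW)))).
Qed.

End ModalFlow.

(* The Lyapunov function is [modal_energy + k * eta * modal_cross] with
   eta = min (d / om) (om / d). *)
Lemma modal_energy_decay : exists C c : R, [/\ 0 < C, 0 < c &
  uniform_modal_decay C c].
Proof.
have [C1 C10 leC1] := modal_energy_bound.
have [k10 k20] := (lyap1_gt0, lyap2_gt0).
have lC0 : 0 <= lyapC by rewrite !(addr_ge0, sqr_ge0, divr_ge0) // ltW.
have A0 : 0 < a + b by rewrite addr_gt0.
have cC0 : 0 < crossC by rewrite !(addr_gt0, divr_gt0, mulr_gt0, exprn_gt0).
(* Makes k <= 1, k crossC <= 1/2 and k lyapC <= 1 at once. The second gives E <= 2 L <= 3 E below,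
   the origin of the factor 3. *)
pose k := (1 + 2 * crossC + lyapC)^-1.
have kd : 0 < 1 + 2 * crossC + lyapC by rewrite ltr_pwDl // addr_gt0 // mulr_gt0.
have k0 : 0 < k by rewrite invr_gt0.
have kE : k * (1 + 2 * crossC + lyapC) = 1 by rewrite mulVf // gt_eqF.
have [kc kl] : 0 < k * crossC /\ 0 <= k * lyapC by rewrite mulr_gt0 ?mulr_ge0 // ltW.
have k_le1 : k <= 1 by lra.
exists 3, (k / (3 * C1)); split=> //; first by rewrite divr_gt0 // mulr_gt0.
move=> d om U V W Z d0 om0 flow t t0.
pose E (t : R) := modal_energy (U t) (V t) (W t) (Z t).
pose F (t : R) := modal_cross (V t + Z t) (a * U t + b * W t) (a * V t + b * Z t)
  (a ^+ 2 * U t + b ^+ 2 * W t).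
pose eta := Num.min (d / om) (om / d).
have eta0 : 0 < eta by rewrite lt_min !divr_gt0.
have ed : eta * d <= om by rewrite -ler_pdivlMr // ge_min lexx orbT.
have eo : eta * om <= d by rewrite -ler_pdivlMr // ge_min lexx.
have eta1 : eta <= 1.
  rewrite ge_min !ler_pdivrMr // !mul1r; exact: le_total.
have rhoE : Num.min d (om ^+ 2 / d) = eta * om.
  by rewrite /eta minr_pMl ?ltW // divfK ?gt_eqF // [in RHS]mulrAC expr2.
set rho := Num.min _ _ in rhoE *; have rho0 : 0 < rho by rewrite rhoE mulr_gt0.
pose L (x : R) := E x + k * eta * F x.
have FE x : k * eta * `|F x| <= E x / 2.
  have h := modal_cross_bound (U x) (V x) (W x) (Z x).
  have E0 := modal_energy_ge0 (U x) (V x) (W x) (Z x).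
  apply: (@le_trans _ _ (k * (crossC * E x))).
    rewrite -mulrA; apply: ler_wpM2l; first exact: ltW.
    by apply: le_trans h; rewrite ler_piMl.
  by rewrite mulrA [leRHS]mulrC ler_wpM2r //; lra.
have [L_ge L_le] : (forall x, E x <= 2 * L x) /\ (forall x, 2 * L x <= 3 * E x).
  have ke : 0 <= k * eta by rewrite mulr_ge0 // ltW.
  split=> x; have := FE x; rewrite /L; have := ler_wpM2l ke (ler_norm (F x));
    have := ler_wpM2l ke (ler_norm (- F x)); rewrite normrN mulrN; lra.
pose dF (t : R) := let s := V t + Z t in let P := a * U t + b * W t in
  let q := a * V t + b * Z t in let Q := a ^+ 2 * U t + b ^+ 2 * W t in
  (- om * P - 2 * d * s) * P + s * (om * q)
    - k1 * (om * q * q + P * (- om * Q - (a + b) * d * s))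
    + k2 * ((- om * Q - (a + b) * d * s) * Q + q * (om * ((a + b) * q - a * b * s))).
pose dL (x : R) := - (2 * d * (V x + Z x) ^+ 2) + k * eta * dF x.
have L_derive (x : R) : 0 < x -> is_derive x 1 L (dL x).
  move=> x0; have dE := modal_energy_derive flow x0; have dF' := modal_cross_derive flow x0.
  exact: (is_deriveD dE (is_deriveZ _ dF')).
have L_cvg : L x @[x --> 0^'+] --> L 0.
  apply: cvgD; first exact: modal_energy_cvg0 flow.
  by apply: cvgM; [exact: cvg_cst | exact: modal_cross_cvg0 flow].
have dL_le (x : R) : 0 < x -> dL x <= - (k / (3 * C1) * rho * L x).
  move=> _; have := modal_cross_dissipation (V x + Z x) (a * U x + b * W x) (a * V x + b * Z x)
    (a ^+ 2 * U x + b ^+ 2 * W x) d0 om0 eta0 ed eo.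
  rewrite -/(dF x) -rhoE -/rho => diss.
  have := leC1 (U x) (V x) (W x) (Z x); rewrite -/(E x) => EC.
  have Lle := L_le x.
  set s2 := (V x + Z x) ^+ 2 in diss EC; have s20 : 0 <= s2 by exact: sqr_ge0.
  move: diss EC; rewrite /dL -/s2; set X := _ + k1 * _ + k2 * _ => diss EC.
  have X0 : 0 <= X by rewrite !(addr_ge0, sqr_ge0, mulr_ge0) // ltW.
  have kdiss := ler_wpM2l (ltW k0) diss.
  have rs : rho * s2 <= d * s2 by rewrite ler_wpM2r // rhoE.
  have ds0 : 0 <= d * s2 by rewrite mulr_ge0 // ltW.
  have kl1 : k * lyapC * (d * s2) <= d * s2 by rewrite ler_piMl //; lra.
  have k1' : k * (rho * s2) <= d * s2.
    by apply: le_trans rs; rewrite ler_piMl // mulr_ge0 // ltW.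
  (* One half of 2 d s^2 pays for the remainder k lyapC d s^2; the other, since rho <= d, supplies
     the missing s^2. *)
  have step : - (2 * d * s2) + k * eta * dF x <= - (k / 2 * rho * (s2 + X)).
    by move: kdiss kl1 k1'; lra.
  apply: (le_trans step); rewrite lerN2.
  have -> : k / (3 * C1) * rho * L x = (k / 2 * rho) * ((2 * L x) / (3 * C1)).
    by field; rewrite gt_eqF.
  apply: ler_wpM2l; first by rewrite ltW // mulr_gt0 // divr_gt0.
  rewrite ler_pdivrMr ?mulr_gt0 // (le_trans Lle) //.
  by rewrite [leRHS]mulrCA ler_wpM2l // mulrC.
have := gronwall L_derive L_cvg dL_le t0; set ex := expR _ => h.
have ex0 : 0 <= ex by exact: expR_ge0.
have := L_ge t; have := ler_wpM2r ex0 (L_le 0).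
by rewrite -/(E t) -/(E 0); lra.
Qed.

End Lyapunov.

(** * Orbits of contraction semigroups *)

Lemma near_right0 (R : realType) (P : R -> Prop) :
  (\forall x \near 0^'+, P x) -> exists2 d : R, 0 < d & forall x, 0 < x -> x < d -> P x.
Proof.
move=> /nbhs_ballP[d /= d0 h]; exists d => // x x0 xd; apply: h => //=.
by rewrite /ball /= sub0r normrN gtr0_norm.
Qed.

Lemma is_derive_little_o (R : realType) (f : R -> R) (t l : R) :
  (forall eps, 0 < eps -> exists2 d, 0 < d &
     forall h, `|h| < d -> `|f (t + h) - f t - h * l| <= eps * `|h|) ->
  is_derive t 1 f l.
Proof.
move=> fl; have cv : (fun h => h^-1 *: ((f \o shift t) (h *: (1 : R)) - f t)) @ 0^' --> l.
  apply/cvgrPdist_le => eps eps0; have [d d0 hd] := fl eps eps0.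
  exists d => //= h; rewrite /ball /= sub0r normrN => hlt h0.
  have nh : 0 < `|h| by rewrite normr_gt0.
  rewrite -(ler_pM2r nh) -normrM mulrBl distrC /GRing.scale /= mulr1.
  have -> : h^-1 * (f (h + t) - f t) * h = f (t + h) - f t.
    by rewrite mulrC mulrA divff // mul1r [h + t]addrC.
  by rewrite [l * h]mulrC hd.
split; first by apply/cvg_ex; exists l.
exact: cvg_lim cv.
Qed.

Section SemigroupOrbits.
Variables (R : realType) (E : lmodType R[i]) (X : set E) (N : E -> R) (S : R -> E -> E).
Hypothesis X_lin : forall (c : R[i]) Z W, X Z -> X W -> X (c *: Z + W).
Hypothesis N_ge0 : forall Z, 0 <= N Z.
Hypothesis sgS : contraction_semigroup X N S.

(** Boundedness refers to [N], which need not come from a topology on [E]. Linearity is over the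
    reals because the coordinates used are real parts. *)
Definition real_functional (l : E -> R) : Prop :=
  (forall (r : R) Z W, X Z -> X W -> l (r%:C *: Z + W) = r * l Z + l W) /\
  exists2 C : R, 0 < C & forall Z, X Z -> `|l Z| <= C * N Z.

Lemma orbit_in (t : R) Z : 0 <= t -> X Z -> X (S t Z).
Proof. by case: sgS => h _ _ _ _ t0 XZ; have [] := h t Z t0 XZ. Qed.

Lemma orbit_le (t : R) Z : 0 <= t -> X Z -> N (S t Z) <= N Z.
Proof. by case: sgS => h _ _ _ _ t0 XZ; have [] := h t Z t0 XZ. Qed.

Lemma orbit_functional l (t : R) : 0 <= t -> real_functional l -> real_functional (l \o S t).
Proof.
move=> t0 [l_lin [C C0 lC]]; have [_ S_lin _ _ _] := sgS; split=> [r Z W XZ XW|].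
  by rewrite /= S_lin // l_lin //; exact: orbit_in.
exists C => // Z XZ; apply: (le_trans (lC _ (orbit_in t0 XZ))).
by rewrite ler_wpM2l ?orbit_le // ltW.
Qed.

Let XB Z W : X Z -> X W -> X (Z - W).
Proof. by move=> XZ XW; rewrite addrC -scaleN1r; exact: X_lin. Qed.

Let lB l Z W : real_functional l -> X Z -> X W -> l (Z - W) = l Z - l W.
Proof.
move=> [l_lin _] XZ XW; rewrite addrC -scaleN1r.
by have := l_lin (-1) W Z XW XZ; rewrite rmorphN rmorph1 => ->; ring.
Qed.

Lemma orbit_cvg0 l Z : real_functional l -> X Z -> l (S t Z) @[t --> 0^'+] --> l (S 0 Z).
Proof.
move=> rl XZ; have [_ _ S0 _ S_cvg] := sgS; rewrite S0 //.
have [C C0 lC] := proj2 rl.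
apply/cvgrPdist_lt => eps eps0; have /cvgrPdist_lt /(_ (eps / C)) := S_cvg Z XZ.
rewrite divr_gt0 // => /(_ isT); apply: filterS2 (nbhs_right_gt 0) => t t0.
rewrite sub0r normrN => lt_eps; have XS := orbit_in (ltW t0) XZ.
rewrite distrC -lB //; apply: (le_lt_trans (lC _ (XB XS XZ))).
by rewrite mulrC -ltr_pdivlMr //; apply: le_lt_trans lt_eps; exact: ler_norm.
Qed.

Section GeneratorOrbit.
Variables (Z W : E).
Hypothesis genZW : generator X N S Z W.

Let XZ : X Z. Proof. by case: genZW. Qed.
Let XW : X W. Proof. by case: genZW. Qed.

Let defect (h : R) : E := (h^-1)%:C *: (S h Z - Z) - W.

Let defect_in (h : R) : 0 < h -> X (defect h).
Proof.
move=> h0; apply: XB => //; rewrite -[_ *: _]addr0; apply: X_lin.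
  by apply: XB => //; apply: orbit_in => //; exact: ltW.
by rewrite -(subrr Z); exact: XB.
Qed.

Let orbit_expand l (h : R) : real_functional l -> 0 < h ->
  l (S h Z) = l Z + h * l W + h * l (defect h).
Proof.
move=> rl h0; have XS := orbit_in (ltW h0) XZ.
have X1 : X (S h Z - Z) by exact: XB.
have X0 : X 0 by rewrite -(subrr Z); exact: XB.
have l0 : l 0 = 0 by rewrite -(subrr Z) lB // subrr.
have XY : X ((h^-1)%:C *: (S h Z - Z)) by rewrite -[_ *: _]addr0; exact: X_lin.
rewrite /defect lB // -[(h^-1)%:C *: _]addr0 (proj1 rl) // l0 lB //.
by field; rewrite gt_eqF.
Qed.

(** The difference quotient at [S t Z] is [S t] applied to the one at [Z], and [S t] is a
    contraction. *)
Lemma orbit_generator (t : R) : 0 <= t -> generator X N S (S t Z) (S t W).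
Proof.
move=> t0; have [_ S_lin _ S_add _] := sgS.
have [_ _ hg] := genZW; split; [exact: orbit_in|exact: orbit_in|].
apply/cvgrPdist_lt => eps eps0; have /cvgrPdist_lt /(_ eps eps0) := hg.
apply: filterS2 (nbhs_right_gt 0) => h h0; rewrite !sub0r !normrN => lt_eps.
have SB Y1 Y2 : X Y1 -> X Y2 -> S t (Y1 - Y2) = S t Y1 - S t Y2.
  by move=> X1 X2; rewrite addrC -scaleN1r S_lin // scaleN1r addrC.
have XS := orbit_in (ltW h0) XZ.
have X1 : X (S h Z - Z) by exact: XB.
have X0 : X 0 by rewrite -(subrr Z); exact: XB.
have XY : X ((h^-1)%:C *: (S h Z - Z)) by rewrite -[_ *: _]addr0; exact: X_lin.
have -> : (h^-1)%:C *: (S h (S t Z) - S t Z) - S t W = S t (defect h).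
  rewrite /defect SB // -[(h^-1)%:C *: (S h Z - Z)]addr0 S_lin //.
  have -> : S t 0 = 0 by have := SB _ _ XZ XZ; rewrite !subrr.
  by rewrite addr0 SB // -!S_add // ?(ltW h0) // [h + t]addrC.
rewrite ger0_norm // (le_lt_trans (orbit_le t0 (defect_in h0))) //.
exact: le_lt_trans (ler_norm _) lt_eps.
Qed.

(** The generator only gives a right derivative. On the left the increment is written from the
    earlier time t + h, and the resulting shift of [W] is absorbed by strong continuity at [W]. *)
Lemma orbit_derive l (t : R) : 0 < t -> real_functional l ->
  is_derive t 1 (fun t => l (S t Z)) (l (S t W)).
Proof.
move=> t0 rl; have [_ _ _ S_add S_cvg] := sgS; have [_ _ hg] := genZW.
have [C C0 lC] := proj2 rl.
apply: is_derive_little_o => eps eps0.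
have e2 : 0 < eps / (2 * C) by rewrite divr_gt0 // mulr_gt0.
have /cvgrPdist_lt /(_ _ e2) /near_right0[d1 d10 h1] := hg.
have /cvgrPdist_lt /(_ _ e2) /near_right0[d2 d20 h2] := S_cvg W XW.
have small1 h : 0 < h -> h < d1 -> C * N (defect h) <= eps / 2.
  move=> h0 hd; have := h1 h h0 hd; rewrite sub0r normrN => /ltW /(le_trans (ler_norm _)).
  by rewrite -(ler_pM2l C0); congr (_ <= _); field; rewrite gt_eqF.
have small2 h : 0 < h -> h < d2 -> C * N (S h W - W) <= eps / 2.
  move=> h0 hd; have := h2 h h0 hd; rewrite sub0r normrN => /ltW /(le_trans (ler_norm _)).
  by rewrite -(ler_pM2l C0); congr (_ <= _); field; rewrite gt_eqF.
(* [t] keeps t + h nonnegative, [d1] controls the difference quotient and [d2] the continuity of the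
   orbit of [W]. *)
exists (Num.min t (Num.min d1 d2)); first by rewrite !lt_min t0 d10 d20.
move=> h; rewrite !lt_min => /and3P[ht hd1 hd2].
have [h0|h0|<-] := ltgtP 0 h; last by rewrite addr0 subrr sub0r mul0r normr0 oppr0 normr0 mulr0.
- rewrite gtr0_norm // in hd1 hd2 *.
  have rl' := orbit_functional (ltW t0) rl.
  rewrite S_add ?(ltW t0) ?(ltW h0) // -[l (S t (S h Z))]/((l \o S t) (S h Z)) (orbit_expand rl' h0).
  have -> : (l \o S t) Z + h * (l \o S t) W + h * (l \o S t) (defect h) - l (S t Z) - h * l (S t W)
    = h * (l \o S t) (defect h) by rewrite /=; ring.
  rewrite normrM gtr0_norm // mulrC ler_wpM2r ?(ltW h0) //.
  rewrite (le_trans (lC _ (orbit_in (ltW t0) (defect_in h0)))) //.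
  apply: (@le_trans _ _ (eps / 2)); last by lra.
  apply: le_trans (small1 _ h0 hd1); rewrite ler_wpM2l ?orbit_le ?(ltW C0) ?(ltW t0) //.
  exact: defect_in.
- rewrite ltr0_norm // in ht hd1 hd2 *; set k := - h in ht hd1 hd2 *.
  have k0 : 0 < k by rewrite oppr_gt0.
  have tk : 0 <= t + h by rewrite /k in ht; lra.
  have rl' := orbit_functional tk rl.
  have tE : t = (t + h) + k by rewrite /k addrK.
  have -> : l (S t Z) = (l \o S (t + h)) (S k Z) by rewrite {1}tE S_add ?(ltW k0).
  have -> : l (S t W) = (l \o S (t + h)) (S k W) by rewrite {1}tE S_add ?(ltW k0).
  rewrite (orbit_expand rl' k0) -[l (S (t + h) Z)]/((l \o S (t + h)) Z).
  have XkW := orbit_in (ltW k0) XW.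
  have [C' C'0 lC'] := proj2 rl'.
  have lC2 Y : X Y -> `|(l \o S (t + h)) Y| <= C * N Y.
    move=> XY; apply: (le_trans (lC _ (orbit_in tk XY))).
    by rewrite ler_wpM2l ?orbit_le // ltW.
  have -> : forall x y z w : R, x - (x + k * y + k * z) - h * w = k * ((w - y) - z).
    by move=> x y z w; rewrite /k; ring.
  rewrite -lB // normrM gtr0_norm // mulrC ler_wpM2r ?(ltW k0) //.
  apply: (le_trans (ler_normB _ _)); have := lC2 _ (XB XkW XW); have := lC2 _ (defect_in k0).
  by have := small1 _ k0 hd1; have := small2 _ k0 hd2; lra.
Qed.

End GeneratorOrbit.
End SemigroupOrbits.

(** * Modes of the coupled system *)

Section CoupledModes.
Context {R : realType} {H : completeNormedModType R[i]}.
Variable ip : {dot H for (@Num.conj R[i])}.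
Hypothesis norm_ip : hilbert_norm ip.
Local Notation rp := (rip ip).
Variables (A B : operator H) (a b gamma : R).
Hypothesis sqrtAB : is_sqrt_of ip A B.
Hypothesis B_coercive : exists2 a0 : R, 0 < a0 &
  forall u, dom B u -> cnorm u <= a0 * cnorm (B u).
Hypotheses (a_gt0 : 0 < a) (b_gt0 : 0 < b) (gamma_gt0 : 0 < gamma).
Variables (mu : nat -> R) (e : nat -> H).
Hypothesis mu_e : is_eigenbasis ip A (mu, e).
Hypothesis basisE : eigenbasis ip A = (mu, e).
Let saB := sqrt_selfadjoint sqrtAB.
Let linB := selfadjoint_linear saB.
Let X : set (H * H * H * H)%type := energy_space B.
Let N : (H * H * H * H)%type -> R := energy_norm B a b.
Let G := A_theta ip A B a b gamma.
Implicit Types Z : (H * H * H * H)%type.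

Lemma energy_space_lin (c : R[i]) Z W : X Z -> X W -> X (c *: Z + W).
Proof.
case: Z W => [[[u v] w] z] [[[u' v'] w'] z'] [du dw] [du' dw'].
by split; apply: (domD linB) => //; apply: (domZ linB).
Qed.

Lemma energy_norm_ge0 Z : 0 <= N Z.
Proof. by case: Z => [[[u v] w] z]; exact: sqrtr_ge0. Qed.

Lemma energy_norm_sqr u v w z : N (u, v, w, z) ^+ 2 =
  a * cnorm (B u) ^+ 2 + cnorm v ^+ 2 + b * cnorm (B w) ^+ 2 + cnorm z ^+ 2.
Proof.
by rewrite sqr_sqrtr // !(addr_ge0, sqr_ge0, mulr_ge0) // ltW.
Qed.

Lemma energy_norm_ge u v w z :
  [/\ cnorm (B u) <= (Num.sqrt a)^-1 * N (u, v, w, z), cnorm v <= N (u, v, w, z),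
      cnorm (B w) <= (Num.sqrt b)^-1 * N (u, v, w, z) & cnorm z <= N (u, v, w, z)].
Proof.
have N0 := energy_norm_ge0 (u, v, w, z); have NE := energy_norm_sqr u v w z.
have [pa pb] : 0 <= a * cnorm (B u) ^+ 2 /\ 0 <= b * cnorm (B w) ^+ 2.
  by split; rewrite mulr_ge0 ?sqr_ge0 // ltW.
have [pv pz] := (sqr_ge0 (cnorm v), sqr_ge0 (cnorm z)).
have sq (c y x : R) : 0 < c -> 0 <= x -> 0 <= y -> c * x ^+ 2 <= y ^+ 2 -> x <= (Num.sqrt c)^-1 * y.
  move=> c0 x0 y0 h; have s0 : 0 < Num.sqrt c by rewrite sqrtr_gt0.
  rewrite mulrC ler_pdivlMr // -(@ler_pXn2r _ 2) ?nnegrE ?mulr_ge0 ?(ltW s0) //.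
  by rewrite exprMn sqr_sqrtr ?(ltW c0) // mulrC.
split; rewrite -?NE; try by apply: sq; rewrite ?cnorm_ge0 // NE; lra.
  by rewrite -(@ler_pXn2r _ 2) ?nnegrE ?cnorm_ge0 // NE; lra.
by rewrite -(@ler_pXn2r _ 2) ?nnegrE ?cnorm_ge0 // NE; lra.
Qed.

Lemma form_eigenl (l : R) x y : dom A x -> A x = l%:C *: x -> dom B y ->
  ip (B x) (B y) = l%:C * ip x y.
Proof.
move=> dx Ax dy; have [_ dBx BBx] := dom_sqrt sqrtAB dx.
by rewrite -(adj saB dBx dy) BBx Ax ipZl.
Qed.

Lemma fpow_lincomb s (c : nat -> R[i]) k :
  fpow ip A s (\sum_(0 <= i < k) c i *: e i) =
  \sum_(0 <= i < k) (mu i `^ s)%:C *: (c i *: e i).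
Proof.
rewrite /fpow /= (fpow_seriesE basisE); apply: cvg_lim; first exact: norm_hausdorff.
apply: cvg_near_cst; exists k => // m /= km.
rewrite /series /= (big_cat_nat (n := k)) //= [X in _ + X]big_nat [X in _ + X]big1 ?addr0.
  apply: eq_big_nat => i /andP[_ ik]; rewrite scalerA; congr ((_ * _) *: _).
  by apply: ip_lincomb ik => i' j' _ _; exact: eigen_orth mu_e i' j'.
move=> i /andP[ki _]; rewrite ip_suml big_nat big1 ?mulr0 ?scale0r // => j /andP[_ jk].
by rewrite ipZl (eigen_orth mu_e) ltn_eqF ?mulr0 // (leq_trans jk).
Qed.

Lemma fpow_dual_lincomb th (c : nat -> R[i]) k p : th <= 1 -> dom B p ->
  fpow_dual ip A th (\sum_(0 <= i < k) c i *: e i) p =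
  \sum_(0 <= i < k) (mu i `^ th)%:C * (c i * ip (e i) p).
Proof.
move=> th1 dp; rewrite /fpow_dual fpow_lincomb ip_suml; apply: eq_bigr => i _.
rewrite -ipZl -(fpow_dual_eigenl norm_ip sqrtAB B_coercive mu_e basisE _ _ th1 dp).
by rewrite /fpow_dual (fpow_eigen mu_e basisE).
Qed.

(** Supplies both the dense set of truncations in the domain and the explicit single-mode
    vectors. *)
Lemma A_theta_lincomb th (cu cv cw cz : nat -> R[i]) k : th <= 1 ->
  let comb (c : nat -> R[i]) := \sum_(0 <= i < k) c i *: e i in
  let force a' c i := (a' * mu i)%:C * c i + (gamma * mu i `^ th)%:C * (cv i + cz i) in
  G th (comb cu, comb cv, comb cw, comb cz)
    (comb cv, - comb (force a cu), comb cz, - comb (force b cw)).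
Proof.
move=> th1 comb force.
have dcomb c : dom B (comb c).
  by apply: (@dom_sum _ _ B linB k c e) => i _; exact: (eigen_dom_sqrt sqrtAB mu_e i).
split; first by split; exact: dcomb.
have key a' c p : dom B p ->
    a'%:C * A_dual ip B (comb c) p + gamma%:C * fpow_dual ip A th (comb cv + comb cz) p =
    to_dual ip (comb (force a' c)) p.
  move=> dp; have -> : comb cv + comb cz = comb (fun i => cv i + cz i).
    by rewrite /comb -big_split /=; apply: eq_bigr => i _; rewrite scalerDl.
  rewrite fpow_dual_lincomb // /A_dual (op_sum linB); last first.
    by move=> i _; exact: (eigen_dom_sqrt sqrtAB mu_e i).
  rewrite /to_dual !ip_suml !mulr_sumr -big_split /=; apply: eq_bigr => i _.
  rewrite !ipZl (form_eigenl (eigen_dom mu_e i) (eigen_op mu_e i) dp).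
  rewrite /force !rmorphM [RHS]mulrDl; congr (_ + _); last by rewrite -!mulrA.
  by rewrite -!mulrA; congr (_ * _); rewrite mulrCA.
by exists (comb (force a cu)), (comb (force b cw)); split=> // p dp; exact: key.
Qed.

(** * Real coordinates along a unit multiple of one eigenvector *)

Section TestVector.
Variables (c : R[i]) (n : nat).
Hypothesis c_unit : complex.Re `|c| = 1.
Let p := c *: e n.
Let om := Num.sqrt (mu n).

Let om_gt0 : 0 < om.
Proof. by rewrite sqrtr_gt0 (eigenvalue_gt0 norm_ip sqrtAB B_coercive mu_e). Qed.

Let om_sqr : om ^+ 2 = mu n.
Proof. by rewrite sqr_sqrtr // ltW // (eigenvalue_gt0 norm_ip sqrtAB B_coercive mu_e). Qed.

Let dBp : dom B p.
Proof. by apply: (domZ linB); exact: (eigen_dom_sqrt sqrtAB mu_e n). Qed.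

Let cnorm_p : cnorm p = 1.
Proof. by rewrite cnormZ c_unit (cnorm_eigen norm_ip mu_e) mulr1. Qed.

Let rip_sqrt u : dom B u -> rp (B u) p = om * rp u p.
Proof.
move=> du; rewrite /rip /p !ipZr (ip_sqrt_eigen norm_ip sqrtAB B_coercive mu_e) //.
by rewrite mulrCA -!ipZr -ipZl -[complex.Re _]/(rip ip _ _) ripZl.
Qed.

(** For [u] in [dom B] this is [rp (B u) p], hence bounded for the energy norm; the factor [om]
    makes the modal equations skew-symmetric up to the weights a, b and the damping. *)
Definition mode_u Z : R := om * rp Z.1.1.1 p.
Definition mode_v Z : R := rp Z.1.1.2 p.
Definition mode_w Z : R := om * rp Z.1.2 p.
Definition mode_z Z : R := rp Z.2 p.
Definition test_energy Z : R := modal_energy a b (mode_u Z) (mode_v Z) (mode_w Z) (mode_z Z).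

Let rip_le u : `|rp u p| <= cnorm u.
Proof. by rewrite (le_trans (cauchy_schwarz norm_ip _ _)) // cnorm_p mulr1. Qed.

Lemma mode_u_functional : real_functional X N mode_u.
Proof.
split=> [r Z W _ _|]; first by rewrite /mode_u /= ripDl ripZl; ring.
exists ((Num.sqrt a)^-1); first by rewrite invr_gt0 sqrtr_gt0.
case=> [[[u v] w] z] [du dw]; rewrite /mode_u /= -rip_sqrt //.
by have [h _ _ _] := energy_norm_ge u v w z; exact: le_trans (rip_le _) h.
Qed.

Lemma mode_v_functional : real_functional X N mode_v.
Proof.
split=> [r Z W _ _|]; first by rewrite /mode_v /= ripDl ripZl.
exists 1 => //; case=> [[[u v] w] z] _; rewrite /mode_v /= mul1r.
by have [_ h _ _] := energy_norm_ge u v w z; exact: le_trans (rip_le _) h.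
Qed.

Lemma mode_w_functional : real_functional X N mode_w.
Proof.
split=> [r Z W _ _|]; first by rewrite /mode_w /= ripDl ripZl; ring.
exists ((Num.sqrt b)^-1); first by rewrite invr_gt0 sqrtr_gt0.
case=> [[[u v] w] z] [du dw]; rewrite /mode_w /= -rip_sqrt //.
by have [_ _ h _] := energy_norm_ge u v w z; exact: le_trans (rip_le _) h.
Qed.

Lemma mode_z_functional : real_functional X N mode_z.
Proof.
split=> [r Z W _ _|]; first by rewrite /mode_z /= ripDl ripZl.
exists 1 => //; case=> [[[u v] w] z] _; rewrite /mode_z /= mul1r.
by have [_ _ _ h] := energy_norm_ge u v w z; exact: le_trans (rip_le _) h.
Qed.

Lemma test_force th a' u v z f : th <= 1 -> dom B u -> dom B v -> dom B z ->
  (forall p, dom B p -> a'%:C * A_dual ip B u p + gamma%:C * fpow_dual ip A th (v + z) p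
     = to_dual ip f p) ->
  ip f p = (a' * mu n)%:C * ip u p + (gamma * mu n `^ th)%:C * (ip v p + ip z p).
Proof.
move=> th1 du dv dz /(_ p dBp); rewrite /to_dual => <-.
rewrite (fpow_dual_eigenr norm_ip sqrtAB B_coercive mu_e basisE) //; last exact: (domD linB).
rewrite /A_dual (opZ linB) ?ipZr; last exact: (eigen_dom_sqrt sqrtAB mu_e n).
rewrite (form_eigen sqrtAB (eigen_dom mu_e n) (eigen_op mu_e n) du).
by rewrite /p ipDl -[in RHS]mulrDr !rmorphM -!mulrA; congr (_ * _ + _); rewrite mulrCA.
Qed.

Variables (th : R) (S : R -> (H * H * H * H)%type -> (H * H * H * H)%type).
Hypotheses (th_le1 : th <= 1) (genS : generates X N (G th) S).
Let d := gamma * mu n `^ th.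
Let sgS : contraction_semigroup X N S := proj1 genS.

(** [S t Z] stays in the domain with image [S t W], so each coordinate has as derivative the same
    coordinate of [S t W], which [test_force] evaluates. *)
Lemma test_flow Z W : G th Z W ->
  modal_flow a b d om (fun t => mode_u (S t Z)) (fun t => mode_v (S t Z))
    (fun t => mode_w (S t Z)) (fun t => mode_z (S t Z)).
Proof.
move=> /(proj2 genS) gZW; have [XZ XW _] := gZW.
split; last first.
  have cvg0 := orbit_cvg0 energy_space_lin sgS.
  split; [exact: (cvg0 _ _ mode_u_functional XZ) | exact: (cvg0 _ _ mode_v_functional XZ) |
    exact: (cvg0 _ _ mode_w_functional XZ) | exact: (cvg0 _ _ mode_z_functional XZ)].
move=> t t0.
have /(proj2 genS) := orbit_generator energy_space_lin energy_norm_ge0 sgS gZW (ltW t0).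
have du := orbit_derive energy_space_lin sgS gZW t0 mode_u_functional.
have dv := orbit_derive energy_space_lin sgS gZW t0 mode_v_functional.
have dw := orbit_derive energy_space_lin sgS gZW t0 mode_w_functional.
have dz := orbit_derive energy_space_lin sgS gZW t0 mode_z_functional.
move: du dv dw dz; case: (S t Z) => [[[u v] w] z]; case: (S t W) => [[[u' v'] w'] z'].
rewrite /mode_u /mode_v /mode_w /mode_z /=.
move=> hu hv hw hz [[du dv dw dz] [f [g [hf hg [Eu Ev Ew Ez]]]]].
rewrite Eu in hu; rewrite Ev in hv; rewrite Ew in hw; rewrite Ez in hz.
have re (k1 k2 : R) (x y : R[i]) : complex.Re (k1%:C * x + k2%:C * y) =
    k1 * complex.Re x + k2 * complex.Re y by case: x y => [x1 x2] [y1 y2] /=; ring.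
have ReD (x y : R[i]) : complex.Re (x + y) = complex.Re x + complex.Re y by case: x y => [x1 x2] [].
have ff := test_force th_le1 du dv dz hf; have gg := test_force th_le1 dw dv dz hg.
split.
- exact: hu.
- exact: hw.
- apply: (is_derive_eq hv); rewrite ripNl {1}/rip ff re ReD /d.
  by set D := gamma * _; rewrite -om_sqr /rip; ring.
- apply: (is_derive_eq hz); rewrite ripNl {1}/rip gg re ReD /d.
  by set D := gamma * _; rewrite -om_sqr /rip; ring.
Qed.

End TestVector.
End CoupledModes.

(** * Parseval identity for the energy and decay of each mode *)

Section ModeDecay.
Context {R : realType} {H : completeNormedModType R[i]}.
Variable ip : {dot H for (@Num.conj R[i])}.
Hypothesis norm_ip : hilbert_norm ip.
Local Notation rp := (rip ip).
Variables (A B : operator H) (a b gamma : R).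
Hypothesis sqrtAB : is_sqrt_of ip A B.
Hypothesis B_coercive : exists2 a0 : R, 0 < a0 &
  forall u, dom B u -> cnorm u <= a0 * cnorm (B u).
Hypotheses (a_gt0 : 0 < a) (b_gt0 : 0 < b) (gamma_gt0 : 0 < gamma).
Variables (mu : nat -> R) (e : nat -> H).
Hypothesis mu_e : is_eigenbasis ip A (mu, e).
Hypothesis basisE : eigenbasis ip A = (mu, e).
Let saB := sqrt_selfadjoint sqrtAB.
Let linB := selfadjoint_linear saB.
Let X : set (H * H * H * H)%type := energy_space B.
Let N : (H * H * H * H)%type -> R := energy_norm B a b.
Let G := A_theta ip A B a b gamma.
Implicit Types Z : (H * H * H * H)%type.
Let mu_gt0 := eigenvalue_gt0 norm_ip sqrtAB B_coercive mu_e.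

Definition mode_sqr (n : nat) (x : H) : R := complex.Re `|ip x (e n)| ^+ 2.

Definition mode_energy (n : nat) Z : R :=
  a * mode_sqr n (B Z.1.1.1) + mode_sqr n Z.1.1.2 + b * mode_sqr n (B Z.1.2) + mode_sqr n Z.2.

(** Splits one complex coefficient into two real ones, so that each complex mode is a sum of two
    real flows with the same [d] and [om]. *)
Lemma mode_sqrE n x : mode_sqr n x = rp x (1 *: e n) ^+ 2 + rp x ('i%C *: e n) ^+ 2.
Proof.
rewrite /mode_sqr scale1r rip_i normc_def /= sqr_sqrtr //.
by rewrite addr_ge0 ?sqr_ge0.
Qed.

Lemma mode_sqr_ge0 n x : 0 <= mode_sqr n x. Proof. exact: sqr_ge0. Qed.

Lemma mode_sqr_sqrt n x : dom B x -> mode_sqr n (B x) = mu n * mode_sqr n x.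
Proof.
move=> dx; rewrite /mode_sqr (ip_sqrt_eigen norm_ip sqrtAB B_coercive mu_e) // Re_normMr.
by rewrite exprMn real_normK ?num_real // sqr_sqrtr // ltW.
Qed.

Lemma mode_energyE n Z : X Z ->
  mode_energy n Z = test_energy ip a b mu e 1 n Z + test_energy ip a b mu e 'i%C n Z.
Proof.
case: Z => [[[u v] w] z] [du dw]; rewrite /mode_energy /= !mode_sqr_sqrt // !mode_sqrE.
rewrite /test_energy /modal_energy /mode_u /mode_v /mode_w /mode_z /= !exprMn.
by rewrite sqr_sqrtr ?ltW //; ring.
Qed.

Lemma mode_energy_ge0 n Z : 0 <= mode_energy n Z.
Proof. by rewrite /mode_energy !(addr_ge0, mode_sqr_ge0, mulr_ge0) // ltW. Qed.

Lemma mode_sqr_cvg x : (fun n => \sum_(0 <= i < n) mode_sqr i x) @ \oo --> cnorm x ^+ 2.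
Proof.
have cx := cvg_cnorm (@fourier_cvg _ _ _ norm_ip _ _ _ mu_e x).
have -> : (fun n => \sum_(0 <= i < n) mode_sqr i x) = (fun n => cnorm (oproj ip e n x) ^+ 2).
  apply/funext => n; rewrite (cnorm_lincomb norm_ip) // => i j _ _.
  exact: (eigen_orth mu_e).
exact: (cvgM cx cx).
Qed.

Lemma energy_norm_modes_cvg Z :
  (fun n => \sum_(0 <= i < n) mode_energy i Z) @ \oo --> N Z ^+ 2.
Proof.
case: Z => [[[u v] w] z]; rewrite (energy_norm_sqr _ a_gt0 b_gt0).
have -> : (fun n => \sum_(0 <= i < n) mode_energy i (u, v, w, z)) =
  (fun n => a * (\sum_(0 <= i < n) mode_sqr i (B u)) + \sum_(0 <= i < n) mode_sqr i v +
    b * (\sum_(0 <= i < n) mode_sqr i (B w)) + \sum_(0 <= i < n) mode_sqr i z).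
  by apply/funext => n; rewrite !mulr_sumr -!big_split.
exact: (cvgD (cvgD (cvgD (cvgM (cvg_cst a) (@mode_sqr_cvg (B u))) (@mode_sqr_cvg v))
  (cvgM (cvg_cst b) (@mode_sqr_cvg (B w)))) (@mode_sqr_cvg z)).
Qed.

Lemma mode_energy_le n Z : mode_energy n Z <= N Z ^+ 2.
Proof.
apply: (cvgr_to_ge (@energy_norm_modes_cvg Z)); exists n.+1 => // k /= nk.
rewrite (bigD1_seq n) ?mem_index_iota ?iota_uniq //= lerDl sumr_ge0 // => i _.
exact: mode_energy_ge0.
Qed.

(** Modal bounds pass to partial sums and then to the limit. Two vectors on the right serve the
    graph norm; exponential stability takes them equal. *)
Lemma energy_norm_le_modes Y Z1 Z2 (K : R) :
  (forall n, mode_energy n Y <= K * (mode_energy n Z1 + mode_energy n Z2)) ->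
  N Y ^+ 2 <= K * (N Z1 ^+ 2 + N Z2 ^+ 2).
Proof.
move=> h; have c1 := @energy_norm_modes_cvg Y.
have c2 : K * (\sum_(0 <= i < n) mode_energy i Z1 + \sum_(0 <= i < n) mode_energy i Z2)
    @[n --> \oo] --> K * (N Z1 ^+ 2 + N Z2 ^+ 2).
  exact: (cvgM (cvg_cst K) (cvgD (@energy_norm_modes_cvg Z1) (@energy_norm_modes_cvg Z2))).
apply: (ler_cvg_to c1 c2); near=> n.
by rewrite /= -big_split mulr_sumr; apply: ler_sum => i _; exact: h.
Unshelve. all: by end_near.
Qed.

Definition partial (k : nat) Z : (H * H * H * H)%type :=
  (oproj ip e k Z.1.1.1, oproj ip e k Z.1.1.2, oproj ip e k Z.1.2, oproj ip e k Z.2).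

Lemma sqrt_oproj k u : dom B u -> B (oproj ip e k u) = oproj ip e k (B u).
Proof.
move=> du; rewrite /oproj (op_sum linB) => [|i _]; last exact: (eigen_dom_sqrt sqrtAB mu_e).
apply: eq_bigr => i _; rewrite (sqrt_eigen norm_ip sqrtAB B_coercive mu_e) scalerA mulrC.
by rewrite (ip_sqrt_eigen norm_ip sqrtAB B_coercive mu_e).
Qed.

Lemma dom_oproj k u : dom B (oproj ip e k u).
Proof. by apply: (dom_sum linB) => i _; exact: (eigen_dom_sqrt sqrtAB mu_e). Qed.

Lemma partial_cvg Z : X Z -> N (partial k Z - Z) @[k --> \oo] --> (0 : R).
Proof.
case: Z => [[[u v] w] z] [du dw].
have pr x : cnorm (oproj ip e k x - x) ^+ 2 @[k --> \oo] --> (0 : R).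
  have /cvg_cnormP h := @fourier_cvg _ _ _ norm_ip _ _ _ mu_e x.
  have -> : (0 : R) = 0 * 0 by rewrite mulr0.
  exact: (cvgM h h).
have h : a * cnorm (oproj ip e k (B u) - B u) ^+ 2 + cnorm (oproj ip e k v - v) ^+ 2 +
    b * cnorm (oproj ip e k (B w) - B w) ^+ 2 + cnorm (oproj ip e k z - z) ^+ 2
    @[k --> \oo] --> a * 0 + 0 + b * 0 + 0.
  exact: (cvgD (cvgD (cvgD (cvgM (cvg_cst a) (pr (B u))) (pr v))
    (cvgM (cvg_cst b) (pr (B w)))) (pr z)).
rewrite !mulr0 !addr0 in h.
have := cvg_comp _ _ h (@sqrt_continuous R 0); rewrite sqrtr0.
apply: cvg_trans; apply: near_eq_cvg; near=> k.
by rewrite /= /N /energy_norm /= !(opB linB) ?sqrt_oproj //; exact: dom_oproj.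
Unshelve. all: by end_near.
Qed.

Section Orbits.
Variables (th : R) (S : R -> (H * H * H * H)%type -> (H * H * H * H)%type).
Hypotheses (th_le1 : th <= 1) (genS : generates X N (G th) S).
Let sgS : contraction_semigroup X N S := proj1 genS.
Let X_lin := energy_space_lin sqrtAB.

Lemma partial_dom k Z : exists W, G th (partial k Z) W.
Proof. by eexists; exact: (A_theta_lincomb norm_ip a b gamma sqrtAB B_coercive mu_e basisE _ _ _ _ _ th_le1). Qed.

Lemma partial_in k Z : X (partial k Z).
Proof. by split; exact: dom_oproj. Qed.

Lemma orbit_partial_cvg l (t : R) Z : 0 <= t -> X Z -> real_functional X N l ->
  l (S t (partial k Z)) @[k --> \oo] --> l (S t Z).
Proof.
move=> t0 XZ rl; have [l_lin [C C0 lC]] := orbit_functional sgS t0 rl.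
apply/cvgrPdist_lt => eps eps0.
have /cvgrPdist_lt /(_ (eps / C)) := partial_cvg XZ.
rewrite divr_gt0 // => /(_ isT); apply: filterS => k; rewrite sub0r normrN => h.
have XD : X (partial k Z - Z).
  by rewrite addrC -scaleN1r; apply: X_lin => //; exact: partial_in.
have -> : l (S t Z) - l (S t (partial k Z)) = - (l \o S t) (partial k Z - Z).
  have := l_lin (-1) Z (partial k Z) XZ (partial_in k Z).
  rewrite rmorphN rmorph1 scaleN1r addrC => -> /=; ring.
rewrite normrN; apply: (le_lt_trans (lC _ XD)).
by rewrite mulrC -ltr_pdivlMr //; apply: le_lt_trans h; exact: ler_norm.
Qed.

Section Decay.
Variables (Cd cd : R).
Hypothesis Cd_decay : uniform_modal_decay a b Cd cd.
Variables (n : nat).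
Let d := gamma * mu n `^ th.
Let d_gt0 : 0 < d. Proof. by rewrite mulr_gt0 ?powR_gt0. Qed.
Let om_gt0 : 0 < Num.sqrt (mu n). Proof. by rewrite sqrtr_gt0. Qed.

Section TestEnergy.
Variable (c : R[i]).
Hypothesis c_unit : complex.Re `|c| = 1.
Let TE Z := test_energy ip a b mu e c n Z.
Let flow := test_flow norm_ip sqrtAB B_coercive a_gt0 b_gt0 mu_e basisE n c_unit th_le1 genS.

Lemma test_energy_partial k Z : (n < k)%N -> TE (partial k Z) = TE Z.
Proof.
move=> nk; have ipE x : rp (oproj ip e k x) (c *: e n) = rp x (c *: e n).
  rewrite /rip !(ipZr ip); congr (complex.Re (_ * _)).
  by apply: ip_lincomb nk => i j _ _; exact: (eigen_orth mu_e).
by rewrite /TE /test_energy /mode_u /mode_v /mode_w /mode_z /= !ipE.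
Qed.

(** The flow bound holds for truncations, which lie in the domain. Beyond index [n] they share the
    [n]-th coordinates of [Z], so the right-hand side is constant while the left converges. *)
Lemma test_energy_decay (t : R) Z : 0 <= t -> X Z ->
  TE (S t Z) <= Cd * TE Z * expR (- (cd * Num.min d (mu n / d) * t)).
Proof.
move=> t0 XZ; set ex := expR _.
have cv : TE (S t (partial k Z)) @[k --> \oo] --> TE (S t Z).
  have hu := orbit_partial_cvg t0 XZ (mode_u_functional norm_ip sqrtAB B_coercive a_gt0 b_gt0 mu_e n c_unit).
  have hv := orbit_partial_cvg t0 XZ (mode_v_functional norm_ip B a_gt0 b_gt0 mu_e n c_unit).
  have hw := orbit_partial_cvg t0 XZ (mode_w_functional norm_ip sqrtAB B_coercive a_gt0 b_gt0 mu_e n c_unit).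
  have hz := orbit_partial_cvg t0 XZ (mode_z_functional norm_ip B a_gt0 b_gt0 mu_e n c_unit).
  exact: (cvgD (cvgD (cvgD (cvgM (cvg_cst _) (cvgM hu hu)) (cvgM hv hv))
    (cvgM (cvg_cst _) (cvgM hw hw))) (cvgM hz hz)).
apply: (cvgr_to_le cv); exists n.+1 => // k /= nk.
have [W GW] := partial_dom k Z; have [_ _ S0 _ _] := sgS.
rewrite -(test_energy_partial Z nk).
have := Cd_decay d_gt0 om_gt0 (flow GW) t0.
by rewrite (S0 _ (partial_in k Z)) sqr_sqrtr ?(ltW (mu_gt0 n)).
Qed.

Lemma test_energy_lower (t : R) Z W : G th Z W -> 0 <= t ->
  TE Z * expR (- (4 * d * t)) <= TE (S t Z).
Proof.
move=> GW t0; have [_ _ S0 _ _] := sgS.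
have XZ : X Z by have [/(_ GW)[]] := proj2 genS Z W.
have := modal_energy_lower a_gt0 b_gt0 d_gt0 (flow GW) t0.
by rewrite (S0 _ XZ).
Qed.

End TestEnergy.

Let unit1 : complex.Re `|1 : R[i]| = 1. Proof. by rewrite normr1. Qed.
Let uniti : complex.Re `|'i%C : R[i]| = 1.
Proof. by rewrite normc_def /= expr0n expr1n add0r sqrtr1. Qed.

Lemma mode_energy_decay (t : R) Z : 0 <= t -> X Z ->
  mode_energy n (S t Z) <= Cd * mode_energy n Z * expR (- (cd * Num.min d (mu n / d) * t)).
Proof.
move=> t0 XZ; rewrite !mode_energyE //; last exact: (orbit_in sgS).
rewrite mulrDr mulrDl.
by apply: lerD; [exact: (test_energy_decay unit1) | exact: (test_energy_decay uniti)].
Qed.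

Lemma mode_energy_lower (t : R) Z W : G th Z W -> 0 <= t ->
  mode_energy n Z * expR (- (4 * d * t)) <= mode_energy n (S t Z).
Proof.
move=> GW t0; have XZ : X Z by have [/(_ GW)[]] := proj2 genS Z W.
rewrite !mode_energyE //; last exact: (orbit_in sgS).
rewrite mulrDl.
by apply: lerD; [exact: (test_energy_lower unit1 GW) | exact: (test_energy_lower uniti GW)].
Qed.

End Decay.
End Orbits.
End ModeDecay.

(** * Stability *)

Section PowerBounds.
Context {R : realType}.
Implicit Types (x y m p k s t th : R).

(** Raise y <= exp(y), for y = k x / p, to the power [p]. *)
Lemma powR_le_expR x p k : 0 < x -> 0 < p -> 0 < k ->
  x `^ p <= (p / k) `^ p * expR (k * x).
Proof.
move=> x0 p0 k0.
have -> : expR (k * x) = expR (k * x / p) `^ p.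
  by rewrite -expRM divfK // gt_eqF.
have pk : 0 <= p / k by rewrite divr_ge0 // ltW.
rewrite -powRM ?expR_ge0 //.
apply: ge0_ler_powR; rewrite ?nnegrE ?(ltW p0) ?(ltW x0) ?(mulr_ge0 pk) ?expR_ge0 //.
have : k * x / p <= expR (k * x / p) by have := expR_ge1Dx (k * x / p); lra.
move=> /(ler_wpM2l pk) h; apply: (le_trans _ h).
by have -> : p / k * (k * x / p) = x by field; rewrite !gt_eqF.
Qed.

(* With y = m^th one has (1 + t)^(-1/th) = m (y + y t)^(-1/th). *)
Lemma expR_decay_powR mu0 k th : 0 < mu0 -> 0 < k -> th < 0 -> exists2 K : R, 0 < K &
  forall m t, mu0 <= m -> 0 <= t ->
    expR (- (k * m `^ th * t)) * (1 + t) `^ (- th^-1) <= K * m.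
Proof.
move=> mu00 k0 th0; set p := - th^-1.
have p0 : 0 < p by rewrite oppr_gt0 invr_lt0.
exists ((p / k) `^ p * expR (k * mu0 `^ th)).
  by rewrite mulr_gt0 ?expR_gt0 // powR_gt0 // divr_gt0.
move=> m t le_m t0; have m0 := lt_le_trans mu00 le_m; set y := m `^ th.
have y0 : 0 < y by rewrite powR_gt0.
have t1 : 0 < 1 + t by rewrite ltr_pwDl.
have yp : y `^ (- p) = m.
  by rewrite /y -powRrM /p opprK mulfV ?lt_eqF // powRr1 // ltW.
have tE : (1 + t) `^ p = m * (y * (1 + t)) `^ p.
  have my1 : m * y `^ p = 1 by rewrite -[X in X * _]yp powRN mulVf // gt_eqF // powR_gt0.
  by rewrite powRM ?(ltW y0) ?(ltW t1) // mulrA my1 mul1r.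
have le1 := powR_le_expR (mulr_gt0 y0 t1) p0 k0.
(* As th < 0, y <= mu0^th, so replacing t by 1 + t costs only a constant factor. *)
have le2 : expR (k * (y * (1 + t))) <= expR (k * mu0 `^ th) * expR (k * y * t).
  rewrite -expRD ler_expR.
  have : k * y <= k * mu0 `^ th by rewrite ler_pM2l // powR_le_of_lb // ltW.
  by lra.
rewrite tE mulrCA [leRHS]mulrC ler_pM2l // mulrC expRN -[leLHS]/(_ / _) ler_pdivrMr ?expR_gt0 //.
apply: (le_trans le1); rewrite -[leRHS]mulrA ler_wpM2l ?powR_ge0 //.
Qed.

Lemma powR_unbounded (u : nat -> R) s : 0 < s -> (forall M, exists n, M < u n) ->
  (forall n, 0 < u n) -> forall M, exists n, M < u n `^ s.
Proof.
move=> s0 hu u0 M; have [n] := hu (`|M| `^ s^-1); exists n.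
apply: (le_lt_trans (ler_norm _)).
have -> : `|M| = (`|M| `^ s^-1) `^ s by rewrite -powRrM mulVf ?gt_eqF // powRr1.
by rewrite gt0_ltr_powR // nnegrE ?powR_ge0 // ltW.
Qed.
End PowerBounds.

Section Stability.
Context {R : realType} {H : completeNormedModType R[i]}.
Variable ip : {dot H for (@Num.conj R[i])}.
Hypothesis norm_ip : hilbert_norm ip.
Local Notation rp := (rip ip).
Variables (A B : operator H) (a b gamma : R).
Hypothesis sqrtAB : is_sqrt_of ip A B.
Hypothesis B_coercive : exists2 a0 : R, 0 < a0 &
  forall u, dom B u -> cnorm u <= a0 * cnorm (B u).
Hypotheses (a_gt0 : 0 < a) (b_gt0 : 0 < b) (gamma_gt0 : 0 < gamma) (a_neq_b : a <> b).
Variables (mu : nat -> R) (e : nat -> H).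
Hypothesis mu_e : is_eigenbasis ip A (mu, e).
Hypothesis basisE : eigenbasis ip A = (mu, e).
Hypothesis mu_unbounded : forall M, exists n, M < mu n.
Let saB := sqrt_selfadjoint sqrtAB.
Let linB := selfadjoint_linear saB.
Let X : set (H * H * H * H)%type := energy_space B.
Let N : (H * H * H * H)%type -> R := energy_norm B a b.
Let G := A_theta ip A B a b gamma.
Implicit Types Z : (H * H * H * H)%type.
Let mu_gt0 := eigenvalue_gt0 norm_ip sqrtAB B_coercive mu_e.
Let N_ge0 := energy_norm_ge0 B a b.

Lemma lincomb_single (c : nat -> R[i]) n : (forall i, i != n -> c i = 0) ->
  \sum_(0 <= i < n.+1) c i *: e i = c n *: e n.
Proof.
move=> c0; rewrite big_nat_recr //= big_nat big1 ?add0r // => i /andP[_ lt_in].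
by rewrite c0 ?scale0r // ltn_eqF.
Qed.

Lemma A_theta_single th (cu cv cw cz : R[i]) n : th <= 1 ->
  let force a' c := (a' * mu n)%:C * c + (gamma * mu n `^ th)%:C * (cv + cz) in
  G th (cu *: e n, cv *: e n, cw *: e n, cz *: e n)
    (cv *: e n, - (force a cu *: e n), cz *: e n, - (force b cw *: e n)).
Proof.
move=> th1 force; pose at_n (c : R[i]) i := if i == n then c else 0.
have := A_theta_lincomb norm_ip a b gamma sqrtAB B_coercive mu_e basisE
  (at_n cu) (at_n cv) (at_n cw) (at_n cz) n.+1 th1.
have at0 c i : i != n -> at_n c i = 0 by rewrite /at_n => /negPf ->.
have atE c : at_n c n = c by rewrite /at_n eqxx.
by rewrite /= !lincomb_single ?atE // => i ni; rewrite !at0 // !(mulr0, addr0).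
Qed.

Section FixedTheta.
Variables (th : R) (S : R -> (H * H * H * H)%type -> (H * H * H * H)%type).
Hypotheses (th_le1 : th <= 1) (genS : generates X N (G th) S).
Let sgS : contraction_semigroup X N S := proj1 genS.
Let X_lin := energy_space_lin sqrtAB.

Lemma exponential_stability : 0 <= th -> exponentially_stable X N S.
Proof.
move=> th0; have [Cd [cd [Cd0 cd0 decay]]] := modal_energy_decay a_gt0 b_gt0 a_neq_b.
have [mu0 mu00 le_mu] := eigenvalue_lb norm_ip sqrtAB B_coercive mu_e.
(* Both entries of min(d, mu_n / d) have nonnegative exponents [th] and [1 - th], hence are smallest
   at the lower bound [mu0]. *)
pose r0 := Num.min (gamma * mu0 `^ th) (mu0 `^ (1 - th) / gamma).
have r00 : 0 < r0 by rewrite lt_min mulr_gt0 ?divr_gt0 ?powR_gt0.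
have r0_le n : r0 <= Num.min (gamma * mu n `^ th) (mu n / (gamma * mu n `^ th)).
  have mono s : 0 <= s -> mu0 `^ s <= mu n `^ s.
    by move=> s0; rewrite ge0_ler_powR ?nnegrE ?(ltW mu00) ?(ltW (mu_gt0 n)).
  rewrite le_min; apply/andP; split.
    by rewrite ge_min ler_pM2l // mono.
  rewrite ge_min; apply/orP; right.
  have -> : mu n / (gamma * mu n `^ th) = mu n `^ (1 - th) / gamma.
    rewrite powRB; last by rewrite (gt_eqF (mu_gt0 n)) implybT.
    by rewrite powRr1 ?(ltW (mu_gt0 n)) // invfM mulrCA mulrC.
  by rewrite ler_pM2r ?invr_gt0 // mono // subr_ge0.
(* Square root and half rate, since the modes control the square of the norm. *)
exists (Num.sqrt Cd), (cd * r0 / 2); split; rewrite ?sqrtr_gt0 ?divr_gt0 ?mulr_gt0 //.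
move=> t t0; apply/ereal_supP => _ [W [Z [XZ NZ [_ ->]]] <-]; rewrite lee_fin.
have NZ2 : N Z ^+ 2 <= 1 by rewrite expr_le1.
rewrite -(@ler_pXn2r _ 2) ?nnegrE ?mulr_ge0 ?sqrtr_ge0 ?expR_ge0 ?N_ge0 //.
rewrite exprMn sqr_sqrtr ?(ltW Cd0) // -expRM_natl.
have le_modes n : mode_energy ip B a b e n (S t Z) <=
    (Cd * expR (- (cd * r0 * t))) / 2 *
    (mode_energy ip B a b e n Z + mode_energy ip B a b e n Z).
  have := mode_energy_decay norm_ip sqrtAB B_coercive a_gt0 b_gt0 gamma_gt0 mu_e basisE
    th_le1 genS decay n t0 XZ.
  set r := Num.min _ _ => h; apply: (le_trans h).
  have -> : Cd * expR (- (cd * r0 * t)) / 2 * (mode_energy ip B a b e n Z + mode_energy ip B a b e n Z)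
    = Cd * mode_energy ip B a b e n Z * expR (- (cd * r0 * t)) by field.
  rewrite ler_wpM2l ?mulr_ge0 ?(ltW Cd0) ?mode_energy_ge0 // ler_expR lerN2.
  by rewrite ler_wpM2r // ler_wpM2l ?(ltW cd0) // r0_le.
have := energy_norm_le_modes norm_ip a_gt0 b_gt0 mu_e le_modes.
move=> h; apply: (le_trans h).
have -> : 2 * - (cd * r0 / 2 * t) = - (cd * r0 * t) by field.
have Ce : 0 <= Cd * expR (- (cd * r0 * t)) by rewrite mulr_ge0 ?expR_ge0 // ltW.
have := ler_wpM2l Ce NZ2; rewrite mulr1 /N; lra.
Qed.

(** A mode with 4 d < xi keeps squared norm at least exp(- xi t), whereas stability would force at
    most K^2 exp(- 2 xi t). *)
Lemma exponential_instability : th < 0 -> ~ exponentially_stable X N S.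
Proof.
move=> th0 [K [xi [K0 xi0 stable]]].
have nth0 : 0 < - th by rewrite oppr_gt0.
have [n hn] := powR_unbounded nth0 mu_unbounded mu_gt0 (4 * gamma / xi).
have d_lt : 4 * (gamma * mu n `^ th) < xi.
  move: hn; rewrite powRN ltr_pdivrMr // [ltRHS]mulrC ltr_pdivlMr ?powR_gt0 //; lra.
pose Z : (H * H * H * H)%type := (0 *: e n, 1 *: e n, 0 *: e n, 0 *: e n).
have [W GZ] : exists W, G th Z W by eexists; exact: (A_theta_single 0 1 0 0 n th_le1).
have [XZ _ _] := proj1 (proj2 genS Z W) GZ.
have NZ : N Z = 1.
  apply/eqP; rewrite -(@eqrXn2 _ 2) // /Z (energy_norm_sqr _ a_gt0 b_gt0).
  rewrite !scale0r scale1r (op0 linB) cnorm0 (cnorm_eigen norm_ip mu_e).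
  by apply/eqP; rewrite !expr0n /= !mulr0 !expr1n !addr0 add0r.
have MZ : mode_energy ip B a b e n Z = 1.
  have m0 : mode_sqr ip e n 0 = 0 by rewrite /mode_sqr ip0l normr0 expr0n.
  have m1 : mode_sqr ip e n (e n) = 1.
    by rewrite /mode_sqr (eigen_orth mu_e) eqxx normr1 expr1n.
  by rewrite /mode_energy /Z !scale0r scale1r /= (op0 linB) m0 m1 !mulr0 !addr0 add0r.
have lower t : 0 <= t -> expR (xi * t) <= K ^+ 2.
  move=> t0; have := mode_energy_lower norm_ip sqrtAB B_coercive a_gt0 b_gt0 gamma_gt0 mu_e
    basisE th_le1 genS n GZ t0.
  rewrite MZ mul1r => h1.
  have h2 := le_trans h1 (mode_energy_le norm_ip B a_gt0 b_gt0 mu_e n (S t Z)).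
  have h3 : N (S t Z) <= K * expR (- (xi * t)).
    rewrite -lee_fin; apply: le_trans (stable t t0); apply: ereal_sup_ubound.
    by exists (S t Z) => //; exists Z; split=> //; rewrite NZ.
  have h4 : N (S t Z) ^+ 2 <= (K * expR (- (xi * t))) ^+ 2.
    by rewrite ler_pXn2r ?nnegrE ?N_ge0 ?mulr_ge0 ?expR_ge0 // ltW.
  have := le_trans h2 h4; rewrite exprMn -expRM_natl => h5.
  have E0 : 0 < expR (2 * - (xi * t)) by exact: expR_gt0.
  rewrite -(ler_pM2r E0); apply: le_trans h5; rewrite -expRD ler_expR.
  have := ler_wpM2r t0 (ltW d_lt); lra.
(* At this time the bound reads exp(K^2) <= K^2, contradicting exp(x) >= 1 + x. *)
have := lower (K ^+ 2 / xi) (divr_ge0 (sqr_ge0 K) (ltW xi0)).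
apply/negP; rewrite -ltNge.
have -> : xi * (K ^+ 2 / xi) = K ^+ 2 by field; rewrite gt_eqF.
by have := expR_ge1Dx (K ^+ 2); lra.
Qed.

(** The energy of [W] contains a mu_n |v|^2 and b mu_n |z|^2, which settles the velocities. The
    positions follow from a mu_n u = f - d (v + z) and its analogue, where d <= gamma mu0^th because
    th <= 0. *)
Lemma mode_energy_graph (mu0 : R) n Z W : th <= 0 -> 0 < mu0 -> mu0 <= mu n -> G th Z W ->
  mu n * mode_energy ip B a b e n Z <=
  (a^-1 + b^-1) * (2 + 4 * (gamma * mu0 `^ th) ^+ 2) *
  (mode_energy ip B a b e n W + mode_energy ip B a b e n Z).
Proof.
case: Z => [[[u v] w] z] th0 mu00 le_mu [[du dv dw dz] [f [g [hf hg ->]]]].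
set d := gamma * mu n `^ th; set D := gamma * mu0 `^ th.
have d0 : 0 < d by rewrite mulr_gt0 ?powR_gt0.
have dD : d ^+ 2 <= D ^+ 2.
  by rewrite ler_pXn2r ?nnegrE ?mulr_ge0 ?powR_ge0 ?(ltW gamma_gt0) // ler_pM2l // powR_le_of_lb.
have unit1 : complex.Re `|1 : R[i]| = 1 by rewrite normr1.
have uniti : complex.Re `|'i%C : R[i]| = 1 by rewrite normc_def /= expr0n expr1n add0r sqrtr1.
have re (k1 k2 : R) (x y x' : R[i]) : complex.Re (k1%:C * x + k2%:C * (y + x')) =
    k1 * complex.Re x + k2 * (complex.Re y + complex.Re x').
  by case: x y x' => [x1 x2] [y1 y2] [z1 z2] /=; ring.
have sq_le (x y1 y2 : R) : (x - d * (y1 + y2)) ^+ 2 <= 2 * x ^+ 2 + 4 * D ^+ 2 * (y1 ^+ 2 + y2 ^+ 2).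
  apply: (@le_trans _ _ (2 * x ^+ 2 + 4 * d ^+ 2 * (y1 ^+ 2 + y2 ^+ 2))).
    rewrite -subr_ge0.
    have -> : 2 * x ^+ 2 + 4 * d ^+ 2 * (y1 ^+ 2 + y2 ^+ 2) - (x - d * (y1 + y2)) ^+ 2 =
      (x + d * (y1 + y2)) ^+ 2 + 2 * (d * (y1 - y2)) ^+ 2 by ring.
    by apply: addr_ge0; [exact: sqr_ge0 | apply: mulr_ge0 => //; exact: sqr_ge0].
  rewrite lerD2l; apply: ler_wpM2r; first by rewrite addr_ge0 ?sqr_ge0.
  exact: ler_wpM2l.
have force a' y f' : dom B y -> (forall p, dom B p ->
      a'%:C * A_dual ip B y p + gamma%:C * fpow_dual ip A th (v + z) p = to_dual ip f' p) ->
    0 < a' -> a' * (mu n * (mu n * mode_sqr ip e n y)) <=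
      a'^-1 * (2 * mode_sqr ip e n f' + 4 * D ^+ 2 * (mode_sqr ip e n v + mode_sqr ip e n z)).
  move=> dy hf' a'0; rewrite !mode_sqrE.
  have test c : complex.Re `|c| = 1 -> (a' * mu n * rp y (c *: e n)) ^+ 2 <=
      2 * rp f' (c *: e n) ^+ 2 + 4 * D ^+ 2 * (rp v (c *: e n) ^+ 2 + rp z (c *: e n) ^+ 2).
    move=> c1; apply: le_trans (sq_le _ _ _).
    have := test_force norm_ip sqrtAB B_coercive mu_e basisE c n th_le1 dy dv dz hf'.
    by move=> /(congr1 (@complex.Re R)); rewrite re -!/(rip ip _ _) => ->; rewrite /d addrK.
  have := lerD (test _ unit1) (test _ uniti).
  have ai : 0 <= a'^-1 by rewrite invr_ge0 ltW.
  move=> /(ler_wpM2l ai) h; apply: (le_trans _ (le_trans h _)).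
    by rewrite le_eqVlt; apply/orP; left; apply/eqP; field; rewrite gt_eqF.
  by rewrite le_eqVlt; apply/orP; left; apply/eqP; ring.
rewrite /mode_energy /=.
rewrite !(mode_sqr_sqrt norm_ip sqrtAB B_coercive mu_e) //.
have modeN y : mode_sqr ip e n (- y) = mode_sqr ip e n y by rewrite /mode_sqr ipNl normrN.
rewrite !modeN.
have hu := force a u f du hf a_gt0; have hw := force b w g dw hg b_gt0.
have [[m0 a0] b0] := (ltW (mu_gt0 n), ltW a_gt0, ltW b_gt0).
have q0 y : 0 <= mode_sqr ip e n y by exact: mode_sqr_ge0.
have [qu qv qw qz] : [/\ 0 <= a * (mu n * mode_sqr ip e n u), 0 <= mode_sqr ip e n v,
    0 <= b * (mu n * mode_sqr ip e n w) & 0 <= mode_sqr ip e n z].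
  by split=> //; apply: mulr_ge0 => //; exact: mulr_ge0.
have [qf qg] := (q0 f, q0 g).
have [qav qbz] : 0 <= a * (mu n * mode_sqr ip e n v) /\ 0 <= b * (mu n * mode_sqr ip e n z).
  by split; apply: mulr_ge0 => //; exact: mulr_ge0.
set S1 := a * (mu n * mode_sqr ip e n v) + _ + _ + _.
set S2 := a * (mu n * mode_sqr ip e n u) + _ + _ + _.
have D0 : 0 <= 4 * D ^+ 2 by apply: mulr_ge0 => //; exact: sqr_ge0.
have [ai bi] : 0 <= a^-1 /\ 0 <= b^-1 by rewrite !invr_ge0.
have vz : 4 * D ^+ 2 * (mode_sqr ip e n v + mode_sqr ip e n z) <= 4 * D ^+ 2 * S2.
  by rewrite ler_wpM2l // /S2; lra.
have [S10 S20] : 0 <= S1 /\ 0 <= S2 by rewrite /S1 /S2; split; lra.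
have tu : a^-1 * (2 * mode_sqr ip e n f + 4 * D ^+ 2 * (mode_sqr ip e n v + mode_sqr ip e n z)
    + a * (mu n * mode_sqr ip e n v)) <= a^-1 * (2 * S1 + 4 * D ^+ 2 * S2).
  by rewrite ler_wpM2l // /S1; lra.
have tw : b^-1 * (2 * mode_sqr ip e n g + 4 * D ^+ 2 * (mode_sqr ip e n v + mode_sqr ip e n z)
    + b * (mu n * mode_sqr ip e n z)) <= b^-1 * (2 * S1 + 4 * D ^+ 2 * S2).
  by rewrite ler_wpM2l // /S1; lra.
have T : (a^-1 + b^-1) * (2 * S1 + 4 * D ^+ 2 * S2) <=
    (a^-1 + b^-1) * ((2 + 4 * D ^+ 2) * (S1 + S2)).
  apply: ler_wpM2l; first exact: addr_ge0.
  have := mulr_ge0 D0 S10; lra.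
have av : mu n * mode_sqr ip e n v = a^-1 * (a * (mu n * mode_sqr ip e n v)).
  by rewrite mulKf // gt_eqF.
have bz : mu n * mode_sqr ip e n z = b^-1 * (b * (mu n * mode_sqr ip e n z)).
  by rewrite mulKf // gt_eqF.
rewrite -mulrA; apply: (le_trans _ T); rewrite mulrDl.
apply: (le_trans _ (lerD tu tw)); rewrite [in leRHS]mulrDr [X in _ <= _ + X]mulrDr -av -bz.
apply: (le_trans _ (lerD (lerD hu (lexx _)) (lerD hw (lexx _)))).
rewrite /S2 le_eqVlt; apply/orP; left; apply/eqP; ring.
Qed.

Lemma polynomial_stability : th < 0 -> exists2 K0 : R, 0 < K0 &
  forall Z W, G th Z W -> forall t : R, 0 <= t ->
    N (S t Z) <= K0 * graph_norm N Z W / (1 + t) `^ (- (1 / (2 * th))).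
Proof.
move=> th0; have [Cd [cd [Cd0 cd0 decay]]] := modal_energy_decay a_gt0 b_gt0 a_neq_b.
have [mu0 mu00 le_mu] := eigenvalue_lb norm_ip sqrtAB B_coercive mu_e.
(* mu_n / d = mu_n^(1 - 2 th) / gamma * mu_n^th with 1 - 2 th > 0, so both entries of the minimum
   dominate a multiple of mu_n^th. *)
pose c1 := Num.min gamma (mu0 `^ (1 - 2 * th) / gamma).
have c10 : 0 < c1 by rewrite lt_min gamma_gt0 divr_gt0 ?powR_gt0.
have c1_le n : c1 * mu n `^ th <= Num.min (gamma * mu n `^ th) (mu n / (gamma * mu n `^ th)).
  have P0 : 0 < mu n `^ th by rewrite powR_gt0.
  rewrite le_min; apply/andP; split; first by rewrite ler_pM2r // ge_min lexx.
  have -> : mu n / (gamma * mu n `^ th) = mu n `^ (1 - 2 * th) / gamma * mu n `^ th.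
    have -> : mu n `^ (1 - 2 * th) = mu n / (mu n `^ th * mu n `^ th).
      rewrite powRB; last by rewrite (gt_eqF (mu_gt0 n)) implybT.
      rewrite powRr1 ?(ltW (mu_gt0 n)) // -powRD; last by rewrite (gt_eqF (mu_gt0 n)) implybT.
      by congr (_ / (_ `^ _)); ring.
    by field; rewrite !gt_eqF.
  rewrite ler_pM2r // ge_min; apply/orP; right; rewrite ler_pM2r ?invr_gt0 //.
  by rewrite ge0_ler_powR ?nnegrE ?(ltW mu00) ?(ltW (mu_gt0 n)) //; lra.
have [K1 K10 leK1] := expR_decay_powR mu00 (mulr_gt0 cd0 c10) th0.
pose C3 := (a^-1 + b^-1) * (2 + 4 * (gamma * mu0 `^ th) ^+ 2).
have C30 : 0 < C3.
  apply: mulr_gt0; first by rewrite addr_gt0 ?invr_gt0.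
  by have := sqr_ge0 (gamma * mu0 `^ th); lra.
pose K := Cd * K1 * C3; have K_gt0 : 0 < K by exact: (mulr_gt0 (mulr_gt0 Cd0 K10) C30).
exists (Num.sqrt K); first by rewrite sqrtr_gt0.
move=> Z W GZW t t0; have [XZ XW _] := proj1 (proj2 genS Z W) GZW.
have t1 : 0 < 1 + t by rewrite ltr_pwDl.
set P := (1 + t) `^ (- th^-1); have P0 : 0 < P by rewrite powR_gt0.
have le_modes n : mode_energy ip B a b e n (S t Z) <=
    (K / P) * (mode_energy ip B a b e n W + mode_energy ip B a b e n Z).
  have := mode_energy_decay norm_ip sqrtAB B_coercive a_gt0 b_gt0 gamma_gt0 mu_e basisE
    th_le1 genS decay n t0 XZ.
  set r := Num.min _ _ => h; apply: (le_trans h).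
  have M0 := mode_energy_ge0 ip B a_gt0 b_gt0 e n Z; set M := mode_energy _ _ _ _ _ n Z in h M0 *.
  have le_e : expR (- (cd * r * t)) <= K1 * mu n / P.
    rewrite ler_pdivlMr //; apply: le_trans (leK1 _ _ (le_mu n) t0).
    rewrite ler_wpM2r ?(ltW P0) // ler_expR lerN2 ler_wpM2r // -mulrA.
    by rewrite ler_wpM2l ?(ltW cd0) // c1_le.
  have CM : 0 <= Cd * M by rewrite mulr_ge0 // ltW.
  apply: (le_trans (ler_wpM2l CM le_e)).
  have -> : Cd * M * (K1 * mu n / P) = Cd * K1 / P * (mu n * M) by field; rewrite gt_eqF.
  have CK : 0 <= Cd * K1 / P by rewrite divr_ge0 ?mulr_ge0 ?(ltW P0) // ltW.
  have := ler_wpM2l CK (mode_energy_graph (ltW th0) mu00 (le_mu n) GZW).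
  rewrite -/C3 -/M; congr (_ <= _); rewrite /K; field; rewrite gt_eqF //.
have := energy_norm_le_modes norm_ip a_gt0 b_gt0 mu_e le_modes => h.
have [NZ NW] := (N_ge0 Z, N_ge0 W).
(* [P] is the weight for the squared norm, [q] its square root; the last comparison is |Z|^2 + |W|^2
   <= (|Z| + |W|)^2. *)
set q := (1 + t) `^ _; have q0 : 0 < q by rewrite powR_gt0.
have qE : q ^+ 2 = P.
  rewrite /q /P -powR_mulrn ?powR_ge0 // -powRrM; congr (_ `^ _).
  by field; rewrite lt_eqF.
rewrite -(@ler_pXn2r _ 2) ?nnegrE ?N_ge0 ?divr_ge0 ?mulr_ge0 ?sqrtr_ge0 ?addr_ge0 ?(ltW q0) //.
rewrite expr_div_n exprMn sqr_sqrtr ?(ltW K_gt0) // qE /graph_norm.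
apply: (le_trans h); rewrite mulrAC ler_pM2r ?invr_gt0 // ler_pM2l //.
have := mulr_ge0 NZ NW; rewrite /N; nra.
Qed.

End FixedTheta.
End Stability.

(** * Growth of the resolvent *)

Section ResolventGrowth.
Context {R : realType} {H : completeNormedModType R[i]}.
Variable ip : {dot H for (@Num.conj R[i])}.
Hypothesis norm_ip : hilbert_norm ip.
Variables (A B : operator H) (a b gamma : R).
Hypothesis sqrtAB : is_sqrt_of ip A B.
Hypothesis B_coercive : exists2 a0 : R, 0 < a0 &
  forall u, dom B u -> cnorm u <= a0 * cnorm (B u).
Hypotheses (a_gt0 : 0 < a) (b_gt0 : 0 < b) (gamma_gt0 : 0 < gamma).
Variables (mu : nat -> R) (e : nat -> H).
Hypothesis mu_e : is_eigenbasis ip A (mu, e).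
Hypothesis basisE : eigenbasis ip A = (mu, e).
Hypothesis mu_unbounded : forall M, exists n, M < mu n.
Let saB := sqrt_selfadjoint sqrtAB.
Let linB := selfadjoint_linear saB.
Let X : set (H * H * H * H)%type := energy_space B.
Let N : (H * H * H * H)%type -> R := energy_norm B a b.
Let G := A_theta ip A B a b gamma.
Let mu_gt0 := eigenvalue_gt0 norm_ip sqrtAB B_coercive mu_e.

(* Approximate eigenvector: with lam^2 = a mu_n the vector
   U = s (e_n, i lam e_n, 0, 0) solves the undamped equation exactly, and
   (i lam - A_theta) U = i d lam s (0, e_n, 0, e_n). *)
Lemma opnorm_resolvent_ge th n : th <= 1 ->
  ((gamma * mu n `^ th)^-1%:E <=
   opnorm X N (resolvent (G th) ('i%C * ((Num.sqrt (a * mu n))%:C)%C)%R))%E.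
Proof.
move=> th1; set d := gamma * mu n `^ th; set lam := Num.sqrt (a * mu n).
have d0 : 0 < d by rewrite mulr_gt0 ?powR_gt0.
have am0 : 0 < a * mu n by exact: (mulr_gt0 a_gt0 (mu_gt0 n)).
have lam0 : 0 < lam by rewrite sqrtr_gt0.
have lam2 : lam ^+ 2 = a * mu n by rewrite sqr_sqrtr ?(ltW am0).
(* Normalises the right-hand side [F] below: its squared norm is 2 (d lam s)^2 = 1, while that of
   [U] is 2 (lam s)^2 = 1 / d^2. *)
pose s := (Num.sqrt 2 * d * lam)^-1.
have s20 : 0 < Num.sqrt 2 :> R by rewrite sqrtr_gt0.
have s0 : 0 < s by rewrite invr_gt0 (mulr_gt0 (mulr_gt0 s20 d0) lam0).
have sE : 2 * (d * lam * s) ^+ 2 = 1.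
  have -> : 2 = Num.sqrt 2 ^+ 2 :> R by rewrite sqr_sqrtr.
  by rewrite -exprMn /s; rewrite (_ : _ * _ = 1) ?expr1n //; field; rewrite !gt_eqF.
have := A_theta_single norm_ip a b gamma sqrtAB B_coercive mu_e basisE
  s%:C ('i%C * (lam * s)%:C) 0 0 n th1.
lazy beta zeta; rewrite -/d !mulr0 !addr0 !add0r !scale0r => GUW.
have cn (x : R) : cnorm (('i%C * x%:C) *: e n) ^+ 2 = x ^+ 2.
  rewrite cnormZ (cnorm_eigen norm_ip mu_e) mulr1 mulrC Re_normMr normc_def /=.
  by rewrite expr0n expr1n add0r sqrtr1 mulr1 real_normK ?num_real.
set U : (H * H * H * H)%type := (s%:C *: e n, ('i%C * (lam * s)%:C) *: e n, 0, 0).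
have NU : N U = d^-1.
  apply/eqP; rewrite -(@eqrXn2 _ 2) ?energy_norm_ge0 ?invr_ge0 ?(ltW d0) //.
  rewrite /N /U (energy_norm_sqr _ a_gt0 b_gt0) cn (op0 linB) cnorm0 expr0n /= !mulr0 !addr0.
  have [de Ae] := (eigen_dom mu_e n, eigen_op mu_e n).
  have [dBe _ _] := dom_sqrt sqrtAB de.
  rewrite (opZ linB) // cnormZr exprMn (cnorm_form_eigen norm_ip sqrtAB de Ae).
  rewrite (cnorm_eigen norm_ip mu_e) expr1n mulr1 real_normK ?num_real // mulrCA -lam2.
  apply/eqP; transitivity (2 * (d * lam * s) ^+ 2 / d ^+ 2); last by rewrite sE mul1r exprVn.
  by field; rewrite gt_eqF.
rewrite -NU; apply: ereal_sup_ubound; exists U => //.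
set F : (H * H * H * H)%type := (0, ('i%C * (d * lam * s)%:C) *: e n, 0, ('i%C * (d * lam * s)%:C) *: e n).
exists F; split.
- by split; exact: (dom0 linB).
- rewrite -(@ler_pXn2r _ 2) ?nnegrE ?energy_norm_ge0 // expr1n.
  rewrite /N /F (energy_norm_sqr _ a_gt0 b_gt0) cn (op0 linB) cnorm0 expr0n /= !mulr0 addr0 add0r.
  by rewrite -mulr2n -mulr_natl sE.
- eexists; first exact: GUW.
  have i2 : 'i%C * 'i%C = -1 :> R[i] by rewrite -expr2 sqr_i.
  have coefv : 'i%C * lam%:C * ('i%C * (lam * s)%:C) +
      ((a * mu n)%:C * s%:C + d%:C * ('i%C * (lam * s)%:C)) = 'i%C * (d * lam * s)%:C.
    rewrite mulrACA i2 mulN1r -!rmorphM addrA -lam2 mulrA -expr2 addNr add0r.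
    by rewrite mulrCA -rmorphM mulrA.
  rewrite /F /U; congr (_, _, _, _).
  + by rewrite /= scalerA -scalerBl rmorphM mulrA subrr scale0r.
  + by rewrite /= scalerA opprK -scalerDl coefv.
  + by rewrite /= scaler0 subr0.
  + by rewrite /= scaler0 opprK add0r mulrCA -rmorphM mulrA.
Qed.

(** Along lam = sqrt(a mu_n) the quantity lam^(-r) / d is a constant times mu_n^(- th - r/2), whose
    exponent is positive exactly when r < - 2 th. *)
Lemma resolvent_growth th r : th < 0 -> r < - 2 * th ->
  limf_esup (fun lambda : R =>
    ((`|lambda| `^ (- r))%:E *
     opnorm X N (resolvent (G th) ('i%C * (lambda%:C)%C)%R))%E)
  (@abs_infty R) = +oo%E.
Proof.
move=> th0 r_lt; have th1 : th <= 1 by lra.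
apply/eqyP => K K0; apply/ereal_infP => _ [V [M hM] <-].
pose s := - th - r / 2; have s0 : 0 < s by rewrite /s; lra.
have cK : 0 < a `^ (- (r / 2)) / gamma by rewrite divr_gt0 ?powR_gt0.
(* The limsup is an infimum over neighbourhoods [V] of infinity: the first condition places the
   frequency in [V], the second lifts the value above [K]. *)
have [n hn] : exists n, `|M| + 1 < (a * mu n) `^ 2^-1 /\ K / (a `^ (- (r / 2)) / gamma) < mu n `^ s.
  pose L1 := ((`|M| + 1) ^+ 2) / a; pose L2 := (K / (a `^ (- (r / 2)) / gamma)) `^ s^-1.
  have [n] := mu_unbounded (Num.max L1 L2); rewrite gt_max => /andP[h1 h2]; exists n.
  have M1 : 0 <= `|M| + 1 by rewrite addr_ge0.
  have KK : 0 <= K / (a `^ (- (r / 2)) / gamma) by rewrite divr_ge0 ?(ltW cK) ?(ltW K0).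
  split.
    have {1}-> : `|M| + 1 = ((`|M| + 1) ^+ 2) `^ 2^-1.
      by rewrite powR12_sqrt ?sqr_ge0 // sqrtr_sqr (ger0_norm M1).
    rewrite gt0_ltr_powR ?invr_gt0 // ?nnegrE ?sqr_ge0 ?mulr_ge0 ?(ltW a_gt0) ?(ltW (mu_gt0 n)) //.
    by rewrite mulrC -ltr_pdivrMr.
  have {1}-> : K / (a `^ (- (r / 2)) / gamma) = L2 `^ s.
    by rewrite /L2 -powRrM mulVf ?gt_eqF // powRr1.
  by rewrite gt0_ltr_powR // ?nnegrE ?powR_ge0 ?(ltW (mu_gt0 n)).
have [hM' hK] := hn.
have am0 : 0 < a * mu n by exact: (mulr_gt0 a_gt0 (mu_gt0 n)).
have sqE : Num.sqrt (a * mu n) = (a * mu n) `^ 2^-1 by rewrite powR12_sqrt // ltW.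
have Vlam : V (Num.sqrt (a * mu n)).
  apply: hM; rewrite ger0_norm ?sqrtr_ge0 // sqE; apply: lt_trans hM'.
  by apply: (le_lt_trans (ler_norm M)); rewrite ltrDl.
apply: (@le_trans _ _ (((`|Num.sqrt (a * mu n)| `^ (- r))%:E *
  opnorm X N (resolvent (G th) ('i%C * ((Num.sqrt (a * mu n))%:C)%C)%R))%E)); last first.
  by apply: ereal_sup_ubound; exists (Num.sqrt (a * mu n)).
apply: le_trans (lee_wpmul2l _ (opnorm_resolvent_ge n th1)); last by rewrite lee_fin powR_ge0.
rewrite -EFinM lee_fin ger0_norm ?sqrtr_ge0 // sqE -powRrM.
have -> : (a * mu n) `^ (2^-1 * - r) / (gamma * mu n `^ th) =
    a `^ (- (r / 2)) / gamma * mu n `^ s.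
  have -> : 2^-1 * - r = - (r / 2) by ring.
  rewrite powRM ?(ltW a_gt0) ?(ltW (mu_gt0 n)) // /s [- th - _]addrC powRD ?(gt_eqF (mu_gt0 n)) ?implybT //.
  by rewrite [mu n `^ (- th)]powRN; field; rewrite !gt_eqF ?powR_gt0.
by rewrite -ler_pdivrMl // mulrC ltW.
Qed.

End ResolventGrowth.

Unset Implicit Arguments.

Theorem theorem1p3 (R : realType) (H : completeNormedModType R[i])
    (ip : {dot H for (@Num.conj R[i])}) (A A12 : operator H) (a b gamma : R)
    (norm_ip : hilbert_norm ip)
    (A_selfadjoint : selfadjoint ip A)
    (A_positive : positive_operator ip A)
    (A_unbounded : unbounded_operator A)
    (A12_sqrt : is_sqrt_of ip A A12)
    (VHV_compact : compact_triple ip A12)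
    (A12_coercive : exists2 a0 : R, 0 < a0 &
       forall u, dom A12 u -> cnorm u <= a0 * cnorm (A12 u))
    (a_gt0 : 0 < a) (b_gt0 : 0 < b) (gamma_gt0 : 0 < gamma) (a_neq_b : a <> b) :
  let X := energy_space A12 in
  let N := energy_norm A12 a b in
  let G := A_theta ip A A12 a b gamma in
  (forall theta : R, 0 <= theta <= 1 ->
     forall S, generates X N (G theta) S -> exponentially_stable X N S) /\
  (forall theta : R, -1 <= theta < 0 ->
     (forall S, generates X N (G theta) S ->
        ~ exponentially_stable X N S /\
        exists2 K0 : R, 0 < K0 &
          forall Z W, G theta Z W -> forall t : R, 0 <= t ->
            N (S t Z) <= K0 * graph_norm N Z W / (1 + t) `^ (- (1 / (2 * theta)))) /\
     (forall r : R, 0 <= r < - 2 * theta ->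
        limf_esup (fun lambda : R =>
            ((`|lambda| `^ (- r))%:E *
             opnorm X N (resolvent (G theta) ('i%C * (lambda%:C)%C)%R))%E)
          (@abs_infty R) = +oo%E)).
Proof.
move=> X N G.
have [V_dense V_compact _ _] := VHV_compact.
(* Existence turns the basis picked by [get] into a genuine eigenbasis, the very one on which [fpow]
   is built. *)
have := getPex (eigenbasis_ex norm_ip A12_sqrt V_compact A_unbounded V_dense).
rewrite -/(eigenbasis ip A); case basisE : (eigenbasis ip A) => [mu e] mu_e.
have mu_unbounded := eigenvalues_unbounded norm_ip A12_sqrt V_compact
  (fun n => conj (eigen_dom mu_e n) (eigen_op mu_e n)) (eigen_orth mu_e).
split=> [theta /andP[th0 th1] S genS|theta /andP[_ th0]].
  exact: (exponential_stability norm_ip A12_sqrt A12_coercive a_gt0 b_gt0 gamma_gt0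
    a_neq_b mu_e basisE th1 genS th0).
have th1 : theta <= 1 by lra.
split=> [S genS|r /andP[_ r_lt]]; last first.
  exact: (resolvent_growth norm_ip A12_sqrt A12_coercive a_gt0 b_gt0 gamma_gt0
    mu_e basisE mu_unbounded th0 r_lt).
split.
  exact: (exponential_instability norm_ip A12_sqrt A12_coercive a_gt0 b_gt0 gamma_gt0
    mu_e basisE mu_unbounded th1 genS th0).
exact: (polynomial_stability norm_ip A12_sqrt A12_coercive a_gt0 b_gt0 gamma_gt0
  a_neq_b mu_e basisE th1 genS th0).
Qed.
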